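(* Let $\mathcal{E}$ be an evolution algebra over $\mathbb{K}$ with natural basis $B=\{e_1,\dots,e_n\}$ such that $\operatorname{supp}\big(\operatorname{SNil}(\mathcal{E})\big)=\operatorname{supp}(\mathcal{E})$. Then the following assertions are equivalent: (i) $\mathcal{E}$ is $\phi$-free; (ii) $\mathcal{E}$ splits over $\operatorname{Asoc}_1(\mathcal{E})$, i.e. there is a subalgebra $U$ of $\mathcal{E}$ with $\mathcal{E}=\operatorname{Asoc}_1(\mathcal{E})\oplus U$ as vector spaces; (iii) $\mathcal{E}$ splits over its annihilator, and its complement can be seen as the direct sum of copies of $\mathcal{E}_2(1,-1)$; that is, $\mathcal{E}=K\oplus\operatorname{ann}(\mathcal{E})$ where $K$ is a subalgebra with $K\cong\bigoplus_{i=1}^m\mathcal{E}_2(1,-1)$ for some integer $0\le m\leq\lfloor\frac{n}{2}\rfloor$ (with $K=0$ if $m=0$); (iv) $\operatorname{SNil}(\mathcal{E})^2=0$ and $\operatorname{SNil}(\mathcal{E})=\mathcal{N}^1(\mathcal{E})$.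
   Context: $\mathbb{K}$ is a field of characteristic different from $2$. An evolution algebra over $\mathbb{K}$ is a finite-dimensional $\mathbb{K}$-algebra (commutative, not necessarily associative) having a basis $B=\{e_1,\dots,e_n\}$, called a natural basis, with $e_ie_j=0$ for $i\neq j$. For $u=\sum\mu_ie_i$, $\operatorname{supp}(u)=\{i:\mu_i\neq0\}$, and for a subspace $U$, $\operatorname{supp}(U)=\bigcup_{u\in U}\operatorname{supp}(u)$ (so $\operatorname{supp}(\mathcal{E})=\{1,\dots,n\}$). $\operatorname{ann}(\mathcal{E})=\{u: u\mathcal{E}=0\}$. For an algebra $\mathcal{A}$ put $\mathcal{A}^1=\mathcal{A}$, $\mathcal{A}^{m+1}=\sum_{i=1}^m\mathcal{A}^i\mathcal{A}^{m+1-i}$, and $\mathcal{A}^{(1)}=\mathcal{A}$, $\mathcal{A}^{(m+1)}=\mathcal{A}^{(m)}\mathcal{A}^{(m)}$; $\mathcal{A}$ is nilpotent (solvable) if $\mathcal{A}^m=0$ (resp. $\mathcal{A}^{(m)}=0$) for some $m$; $\mathcal{A}^2$ is the derived subalgebra; an ideal is nilpotent if it is so as an algebra; an ideal $I$ is abelian if $I^2=0$. An ideal $I$ of $\mathcal{E}$ is $\mathcal{E}$-supersolvable if there is a chain $0=I_0\subsetneq I_1\subsetneq\dots\subsetneq I_s=I$ with each $I_i$ an ideal of $\mathcal{E}$ and $\dim I_i=i$. The supersolvable nilradical $\operatorname{SNil}(\mathcal{E})$ is the largest $\mathcal{E}$-supersolvable nilpotent ideal of $\mathcal{E}$ (a largest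 such ideal exists). $\operatorname{Asoc}_1(\mathcal{E})$ is the sum of all one-dimensional abelian ideals of $\mathcal{E}$. $\mathcal{E}_2(1,-1)$ is the two-dimensional evolution algebra with natural basis $\{e_1,e_2\}$ and $e_1^2=-e_2^2=e_1+e_2$. The Frattini subalgebra $F(\mathcal{E})$ is the intersection of all maximal subalgebras of $\mathcal{E}$; the Frattini ideal $\phi(\mathcal{E})$ is the largest ideal of $\mathcal{E}$ contained in $F(\mathcal{E})$; $\mathcal{E}$ is $\phi$-free if $\phi(\mathcal{E})=0$. $\mathcal{T}_{\mathbb{K}}$ is the class of solvable, non-nilpotent evolution algebras over $\mathbb{K}$ with one-dimensional derived subalgebra; every $\mathcal{A}\in\mathcal{T}_{\mathbb{K}}$ has a unique maximal nilpotent ideal $\operatorname{Nil}(\mathcal{A})$. If $J=\operatorname{span}\{w\}$ is a one-dimensional abelian ideal of $\mathcal{E}$ not contained in $\operatorname{ann}(\mathcal{E})$, then $\mathcal{E}_J=\operatorname{span}\{e_k: k\in\operatorname{supp}(w)\}$ is an ideal of $\mathcal{E}$ belonging to $\mathcal{T}_{\mathbb{K}}$ with derived subalgebra $J$. The ideal $\mathcal{N}^1(\mathcal{E})$ is $$\mathcal{N}^1(\mathcal{E})=\sum_{J}\operatorname{Nil}(\mathcal{E}_J)+\operatorname{ann}(\mathcal{E}),$$ the sum being over all one-dimensional abelian ideals $J$ of $\mathcal{E}$ not contained in $\operatorname{ann}(\mathcal{E})$. *)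

(* Defs.v *)
From mathcomp Require Import all_boot all_algebra.
From mathcomp Require Import boolp classical_sets.

Set Implicit Arguments.
Unset Strict Implicit.
Unset Printing Implicit Defensive.

Import GRing.Theory.

Local Open Scope ring_scope.

Section Subspaces.
Variables (K : fieldType) (E : vectType K).
Implicit Types (U V W : {vspace E}) (P : {vspace E} -> Prop).

(* The subspace whose set of elements is S; see vspace_ofP. *)
Definition vspace_of (S : E -> Prop) : {vspace E} :=
  xget 0%VS (fun W : {vspace E} => forall v, v \in W <-> S v).

(* The sum of a possibly infinite family of subspaces; see sum_ofP. *)
Definition sum_of P : {vspace E} :=
  vspace_of (fun v => exists2 s : seq {vspace E},
    (forall U, U \in s -> P U) & v \in (\sum_(U <- s) U)%VS).

Definition is_largest P U := P U /\ forall V, P V -> (V <= U)%VS.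

Definition is_maximal P U := P U /\ forall V, P V -> (U <= V)%VS -> V = U.

Definition largest P : {vspace E} := xget 0%VS (is_largest P).

Lemma ex_max_dim P U0 : P U0 ->
  exists2 U, P U & forall V, P V -> (\dim V <= \dim U)%N.
Proof.
move=> PU0.
have exP : exists k, `[< exists2 U, P U & \dim U = k >].
  by exists (\dim U0); apply/asboolP; exists U0.
have bnd k : `[< exists2 U, P U & \dim U = k >] -> (k <= \dim {:E})%N.
  by move=> /asboolP[U _ <-]; apply/dimvS/subvf.
case: (ex_maxnP exP bnd) => k /asboolP[U PU dU] max_k.
by exists U => // V PV; rewrite dU; apply: max_k; apply/asboolP; exists V.
Qed.

Lemma largest_ex P : P 0%VS -> (forall U V, P U -> P V -> P (U + V)%VS) ->
  is_largest P (largest P).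
Proof.
move=> P0 PD; apply: xgetPex; have [U PU maxU] := ex_max_dim P0.
exists U; split=> // V PV.
have /eqP -> : U == (U + V)%VS.
  by rewrite eqEdim addvSl; apply: maxU; apply: PD.
exact: addvSr.
Qed.

Lemma vspace_ofP (S : E -> Prop) :
    S 0 -> (forall (a : K) u v, S u -> S v -> S (a *: u + v)) ->
  forall v, v \in vspace_of S <-> S v.
Proof.
move=> S0 SD; rewrite /vspace_of.
have SDr u v : S u -> S v -> S (u + v).
  by move=> Su Sv; rewrite -[u]scale1r; apply: SD.
apply: (@xgetPex _ _ (fun W : {vspace E} => forall v, v \in W <-> S v)).
have P0 : forall v : E, v \in 0%VS -> S v by move=> v; rewrite memv0 => /eqP ->.
have [U SU maxU] := ex_max_dim (P := fun U => forall v, v \in U -> S v) P0.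
exists U => v; split; [exact: SU | move=> Sv].
have /eqP -> : U == (U + <[v]>)%VS.
  rewrite eqEdim addvSl; apply: maxU => _ /memv_addP[u Uu [_ /vlineP[a ->] ->]].
  by rewrite addrC; apply: SD => //; apply: SU.
by apply: (subvP (addvSr _ _)); apply: memv_line.
Qed.

Lemma sum_ofE P v : v \in sum_of P <->
  exists2 s : seq {vspace E}, (forall U, U \in s -> P U)
                            & v \in (\sum_(U <- s) U)%VS.
Proof.
move: v; apply: vspace_ofP => [|a u v [s Ps su] [t Pt tv]].
  by exists [::] => //; rewrite mem0v.
exists (s ++ t) => [U|]; first by rewrite mem_cat => /orP[/Ps|/Pt].
by rewrite big_cat /=; apply: memv_add => //; apply: memvZ.
Qed.

Lemma sum_ofP P V : (sum_of P <= V)%VS <-> forall U, P U -> (U <= V)%VS.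
Proof.
split=> [sPV U PU | sPV].
  apply/subvP => v Uv; apply: (subvP sPV); apply/sum_ofE; exists [:: U].
    by move=> W; rewrite inE => /eqP ->.
  by rewrite big_seq1.
apply/subvP => v /sum_ofE[s Ps]; apply: subvP v.
by rewrite big_seq; elim/big_ind: _ => [|U W sU sW|U /Ps/sPV //];
   [apply: sub0v | rewrite subv_add sU].
Qed.

End Subspaces.

Section Algebra.
Variables (K : fieldType) (E : vectType K) (mul : E -> E -> E).
Implicit Types (A I J N U V W M : {vspace E}) (u v w : E).

(* The span of all products; see prodmP. *)
Definition prodm U V : {vspace E} :=
  <<[seq mul u v | u <- vbasis U, v <- vbasis V]>>%VS.

Definition subalgebra U := (prodm U U <= U)%VS.

Definition ideal_of A I :=
  [&& (I <= A)%VS, (prodm A I <= I)%VS & (prodm I A <= I)%VS].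

Definition ideal I := ideal_of fullv I.

Definition abelian_ideal I := ideal I && (prodm I I == 0%VS).

Definition ann : {vspace E} := vspace_of (fun u => forall v, mul u v = 0).

(* The i-th entry of powers A m is A^(i+1), for i < m. *)
Fixpoint powers A m : seq {vspace E} :=
  if m is m'.+1 then
    let s := powers A m' in
    rcons s (if m' is 0 then A
             else \sum_(i < m') prodm (nth 0 s i) (nth 0 s (m'.-1 - i)))%VS
  else [::].

(* A^m; only meaningful for m > 0, see power1 and powerS. *)
Definition power A m : {vspace E} := nth 0%VS (powers A m) m.-1.

Definition nilpotent A := exists2 m, (0 < m)%N & power A m = 0%VS.

Definition supersolvable I :=
  exists (s : nat) (c : nat -> {vspace E}),
  [/\ c 0%N = 0%VS, c s = I,
      forall i, (i <= s)%N -> ideal (c i) /\ \dim (c i) = i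
    & forall i, (i < s)%N -> (c i <= c i.+1)%VS /\ c i <> c i.+1].

(* Such a largest ideal exists: see SNilP. *)
Definition SNil : {vspace E} :=
  largest (fun I => [/\ ideal I, supersolvable I & nilpotent I]).

(* A maximal nilpotent ideal of the subalgebra A, chosen by xget; there is only
   one when A is solvable, non-nilpotent and \dim (A A) = 1, as is the case of
   the algebras A = supp_ideal w of N1. *)
Definition Nil A : {vspace E} :=
  xget 0%VS (is_maximal (fun N => ideal_of A N /\ nilpotent N)).

Definition Asoc1 : {vspace E} :=
  sum_of (fun J => abelian_ideal J /\ \dim J = 1%N).

Definition maximal_subalgebra :=
  is_maximal (fun M => subalgebra M /\ M <> fullv).

Definition Frattini : {vspace E} :=
  vspace_of (fun v => forall M, maximal_subalgebra M -> v \in M).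

(* Such a largest ideal exists: see phiP. *)
Definition phi : {vspace E} :=
  largest (fun I => ideal I /\ (I <= Frattini)%VS).

Definition phi_free := phi = 0%VS.

Definition complement_of U V := (U + V = fullv)%VS /\ (U :&: V = 0)%VS.

Definition splits_over I := exists2 U, subalgebra U & complement_of I U.

Variables (n : nat) (e : n.-tuple E).

(* This makes mul commutative: see natural_basis_mulC. *)
Definition natural_basis :=
  basis_of fullv e /\ forall i j : 'I_n, i != j -> mul e`_i e`_j = 0.

Definition supp u : {set 'I_n} := [set i | coord e i u != 0]%SET.

Definition suppv U : {set 'I_n} :=
  [set i | `[< exists2 u, u \in U & i \in supp u >]]%SET.

(* The span of the basis vectors in the support of w; for J = <[w]> a
   one-dimensional abelian ideal outside ann, this is the ideal E_J. *)
Definition supp_ideal w : {vspace E} := (\sum_(k in supp w) <[e`_k]>)%VS.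

Definition N1 : {vspace E} :=
  (sum_of (fun N => exists w : E,
     [/\ abelian_ideal <[w]>, \dim <[w]> = 1%N, ~~ (<[w]> <= ann)%VS
       & N = Nil (supp_ideal w)]) + ann)%VS.

End Algebra.

(* The product on K^2 with canonical basis e_1, e_2 a natural basis and
   e_1^2 = e_1 + e_2 = - e_2^2. *)
Definition E2mul (K : fieldType) (u v : 'rV[K]_2) : 'rV[K]_2 :=
  let sq1 := delta_mx 0 0 + delta_mx 0 1 in
  (u 0 0 * v 0 0) *: sq1 + (u 0 1 * v 0 1) *: - sq1.

(* U is the image of an injective algebra morphism from the direct sum of m
   copies of E_2(1,-1), realised as the functions from 'I_m to K^2 with the
   pointwise product. *)
Definition iso_E2_sum (K : fieldType) (E : vectType K) (mul : E -> E -> E)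
    (m : nat) (U : {vspace E}) :=
  exists f : 'Hom({ffun 'I_m -> 'rV[K]_2}, E),
  [/\ lker f = 0%VS, limg f = U
    & forall x y : {ffun 'I_m -> 'rV[K]_2},
        f [ffun i => E2mul (x i) (y i)] = mul (f x) (f y)].

Section Facts.
Variables (K : fieldType) (E : vectType K) (mul : {bilinear E -> E -> E}).
Implicit Types (A I J N U V W M : {vspace E}) (u v w : E).

Lemma prodmP U V W :
  reflect (forall u v, u \in U -> v \in V -> mul u v \in W)
          (prodm mul U V <= W)%VS.
Proof.
apply: (iffP span_subvP) => [sW u v Uu Vv | sW _ /allpairsP[[u v] [/= Uu Vv ->]]].
  rewrite (coord_vbasis Uu) (coord_vbasis Vv) linear_sumlz.
  apply: memv_suml => i _; rewrite linear_sumr; apply: memv_suml => j _.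
  rewrite linearZl_LR linearZr_LR; do 2!apply: memvZ.
  by apply: sW; apply: allpairs_f; apply: mem_nth; rewrite size_tuple.
by apply: sW; apply: vbasis_mem.
Qed.

Lemma annP u : u \in ann mul <-> forall v, mul u v = 0.
Proof.
move: u; apply: vspace_ofP => [v|a u w u0 w0 v]; first by rewrite linear0l.
by rewrite linearDl linearZl_LR u0 w0 scaler0 addr0.
Qed.

Lemma FrattiniP v :
  v \in Frattini mul <-> forall M, maximal_subalgebra mul M -> v \in M.
Proof.
move: v; apply: vspace_ofP => [M _|a u w Fu Fw M maxM]; first exact: mem0v.
by apply: memvD; [apply: memvZ; apply: Fu | apply: Fw].
Qed.

Lemma size_powers A m : size (powers mul A m) = m.
Proof. by elim: m => //= m IHm; rewrite size_rcons IHm. Qed.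

Lemma nth_powers A m i : (i < m)%N ->
  nth 0%VS (powers mul A m) i = power mul A i.+1.
Proof.
elim: m => // m IHm; rewrite ltnS leq_eqVlt => /predU1P[-> // | lt_im].
by rewrite /= nth_rcons size_powers lt_im; apply: IHm.
Qed.

Lemma power1 A : power mul A 1 = A.
Proof. by []. Qed.

Lemma powerS A m : (0 < m)%N ->
  power mul A m.+1 =
  (\sum_(1 <= i < m.+1) prodm mul (power mul A i) (power mul A (m.+1 - i)))%VS.
Proof.
case: m => // m _; rewrite {1}/power /= -/(powers mul A m.+1).
rewrite nth_rcons size_powers ltnn eqxx big_add1 big_mkord.
apply: eq_bigr => i _; rewrite !nth_powers ?ltn_ord ?ltnS ?leq_subr //.
by rewrite subSS subSn // -ltnS.
Qed.

Lemma ideal0 : ideal mul 0%VS.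
Proof.
apply/and3P; split; first exact: sub0v.
  by apply/prodmP => u v _; rewrite memv0 => /eqP ->; rewrite linear0r mem0v.
by apply/prodmP => u v; rewrite memv0 => /eqP -> _; rewrite linear0l mem0v.
Qed.

Lemma idealP I :
  reflect (forall u v, v \in I -> mul u v \in I /\ mul v u \in I) (ideal mul I).
Proof.
apply: (iffP and3P) => [[_ /prodmP lI /prodmP rI] u v Iv | iI].
  by split; [apply: lI | apply: rI] => //; apply: memvf.
split; first exact: subvf.
  by apply/prodmP => u v _ /iI-/(_ u)[].
by apply/prodmP => u v /iI-/(_ v)[].
Qed.

Lemma idealD I J : ideal mul I -> ideal mul J -> ideal mul (I + J)%VS.
Proof.
move=> /idealP iI /idealP iJ.
apply/idealP => u _ /memv_addP[x Ix [y Jy ->]].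
have [[ux xu] [uy yu]] := (iI u x Ix, iJ u y Jy).
by rewrite linearDr linearDl; split; apply: memv_add.
Qed.

Lemma phiP :
  is_largest (fun I => ideal mul I /\ (I <= Frattini mul)%VS) (phi mul).
Proof.
apply: largest_ex => [|U V [iU sU] [iV sV]].
  by split; [apply: ideal0 | apply: sub0v].
by split; [apply: idealD | rewrite subv_add sU].
Qed.

Lemma supersolvable_ext U V : supersolvable mul U -> ideal mul V ->
  (U <= V)%VS -> (\dim V <= (\dim U).+1)%N -> supersolvable mul V.
Proof.
move=> ssU iV sUV; rewrite leq_eqVlt ltnS => /orP[/eqP dV | dVU]; last first.
  by have /eqP <- : U == V by rewrite eqEdim sUV.
case: ssU => s [c [c0 cs cP cS]]; have [_ ds] := cP s (leqnn s).
rewrite -cs ds in dV.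
exists s.+1, (fun i => if (i <= s)%N then c i else V); split=> //.
- by rewrite ltnn.
- move=> i; rewrite [(i <= _)%N]leq_eqVlt ltnS => /predU1P[-> | le_is].
    by rewrite ltnn.
  by rewrite le_is; apply: cP.
move=> i lt_iS; have: (i == s) || (i < s)%N by rewrite -leq_eqVlt.
case/predU1P=> [-> | lt_is]; last first.
  by rewrite /= lt_is (ltnW lt_is); apply: cS.
rewrite ltnn leqnn cs; split=> // eqUV.
by move/eqP: dV; rewrite -eqUV -cs ds ltn_eqF.
Qed.

Lemma supersolvableD I J : ideal mul I ->
  supersolvable mul I -> supersolvable mul J -> supersolvable mul (I + J)%VS.
Proof.
move=> iI ssI [s [c [c0 <- cP cS]]].
have: (s <= s)%N by []; elim: {1 3}s => [|i IHi] lt_is.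
  by rewrite c0 addv0.
have [sc _] := cS i lt_is; have [_ di] := cP i (ltnW lt_is).
have [ic dc] := cP _ lt_is.
apply: (supersolvable_ext (IHi (ltnW lt_is))); first exact: idealD.
  exact: addvS.
have -> : (I + c i.+1 = (I + c i) + c i.+1)%VS.
  by rewrite -addvA (addv_idPr sc).
have sci : (c i <= (I + c i) :&: c i.+1)%VS by rewrite subv_cap addvSr.
have := dimv_sum_cap (I + c i) (c i.+1); move/dimvS: sci; rewrite di dc => le_i.
by move=> dD; rewrite -(leq_add2r i) addSnnS -dD leq_add2l.
Qed.

Lemma natural_basis_mulC n (e : n.-tuple E) :
  natural_basis mul e -> commutative mul.
Proof.
case=> /andP[/eqP spanE _] mul0 u v.
have cE x : x = \sum_i coord e i x *: e`_i.
  by apply: coord_span; rewrite spanE memvf.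
rewrite (cE u) (cE v) !linear_sumlz.
under eq_bigr do rewrite linear_sumr.
under [RHS]eq_bigr do rewrite linear_sumr.
rewrite exchange_big; apply: eq_bigr => j _; apply: eq_bigr => i _.
rewrite !linearZl_LR !linearZr_LR !scalerA mulrC.
by have [-> // | neq_ij] := eqVneq i j; rewrite !mul0 // eq_sym.
Qed.

Hypothesis mulC : commutative mul.

Lemma nilpotent_chain N U V : ideal mul N -> nilpotent mul N ->
    ideal mul U -> ideal mul V -> (U <= V)%VS -> (\dim V <= (\dim U).+1)%N ->
  (prodm mul N V <= U)%VS.
Proof.
move=> /idealP iN [m m0 Nm] /idealP iU /idealP iV sUV dV.
apply/prodmP => y x Ny Vx; set z := mul y x.
have Nz : z \in N by have [] := iN x y Ny.
have Vz : z \in V by have [] := iV y x Vx.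
apply: contraT => nUz.
have defV : V = (U + <[z]>)%VS.
  apply/esym/eqP; rewrite eqEdim subv_add sUV -memvE Vz /=.
  apply: leq_trans dV _; rewrite ltnNge; apply: contra nUz => dle.
  have /eqP -> : U == (U + <[z]>)%VS by rewrite eqEdim addvSl.
  by rewrite (subvP (addvSr _ _)) ?memv_line.
move: Vx; rewrite defV => /memv_addP[a Ua [_ /vlineP[k ->] def_x]].
have step : z = mul y a + k *: mul y z.
  by rewrite {1}/z def_x linearDr linearZr_LR.
suff: z \in (U + power mul N m)%VS by rewrite Nm addv0 (negPf nUz).
elim: m m0 {Nm} => // -[|m] IHm _.
  by rewrite power1 (subvP (addvSr _ _)).
have /memv_addP[b Ub [c Nc def_z]] := IHm isT.
have -> : z = (mul y a + k *: mul y b) + k *: mul y c.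
  by rewrite {1}step {1}def_z linearDr scalerDr addrA.
apply: memv_add.
  by apply: memvD; rewrite ?memvZ //; [have [] := iU y a Ua | have [] := iU y b Ub].
apply: memvZ; rewrite (powerS N (ltn0Sn m)) big_ltn // subSS subn0 power1.
apply: (subvP (addvSl _ _)); have /prodmP := subvv (prodm mul N (power mul N m.+1)).
exact.
Qed.

Lemma SNilP :
  is_largest (fun I => [/\ ideal mul I, supersolvable mul I & nilpotent mul I])
             (SNil mul).
Proof.
apply: largest_ex => [|I J [iI ssI nI] [iJ ssJ nJ]].
  split; first exact: ideal0.
    exists 0%N, (fun=> 0%VS); split=> // i; rewrite leqn0 => /eqP ->.
    by rewrite dimv0; split=> //; apply: ideal0.
  by exists 1%N.
set W := (I + J)%VS.
have iW : ideal mul W by apply: idealD.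
have ssW : supersolvable mul W by apply: supersolvableD.
split=> //; case: (ssW) => s [c [c0 cs cP cS]].
have WcS i : (i < s)%N -> (prodm mul W (c i.+1) <= c i)%VS.
  move=> lt_is; have [ici di] := cP i (ltnW lt_is).
  have [icS dS] := cP i.+1 lt_is; have [sc _] := cS i lt_is.
  have dle : (\dim (c i.+1) <= (\dim (c i)).+1)%N by rewrite dS di.
  have /prodmP Ic := nilpotent_chain iI nI ici icS sc dle.
  have /prodmP Jc := nilpotent_chain iJ nJ ici icS sc dle.
  apply/prodmP => _ v /memv_addP[x Ix [y Jy ->]] cv.
  by rewrite linearDl; apply: memvD; [apply: Ic | apply: Jc].
have prodS U V U' V' : (U <= U')%VS -> (V <= V')%VS ->
    (prodm mul U V <= prodm mul U' V')%VS.
  move=> /subvP sU /subvP sV; apply/prodmP => u v /sU Uu /sV Vv.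
  by have /prodmP := subvv (prodm mul U' V'); apply.
have sum_sub (F : nat -> {vspace E}) m V :
    (forall i, (1 <= i < m)%N -> (F i <= V)%VS) ->
    (\sum_(1 <= i < m) F i <= V)%VS.
  move=> sFV; rewrite big_nat; elim/big_ind: _ => //; first exact: sub0v.
  by move=> U1 U2 sU1 sU2; rewrite subv_add sU1.
have powW m : (0 < m)%N -> (power mul W m <= W)%VS.
  elim/ltn_ind: m => -[|[|m]] // IHm _.
  rewrite powerS //; apply: sum_sub => i /andP[i0 lt_i].
  have i'0 : (0 < m.+2 - i)%N by rewrite subn_gt0.
  have /and3P[_ sWW _] := iW; apply: subv_trans sWW.
  by apply: prodS; [apply: subvf | apply: IHm => //; rewrite ltn_subrL i0].
have powk k m : (k <= s)%N -> (2 ^ k <= m)%N -> (power mul W m <= c (s - k)%N)%VS.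
  elim: k m => [|k IHk] m le_ks le_m; first by rewrite subn0 cs; apply: powW.
  have m2 : (2 <= m)%N by apply: leq_trans le_m; rewrite expnS leq_pmulr ?expn_gt0.
  case: m m2 le_m => // m m1; rewrite expnS mul2n -addnn => le_m.
  rewrite powerS //; apply: sum_sub => i /andP[i0 lt_i].
  have defk : (s - k = (s - k.+1).+1)%N by rewrite subnSK.
  have Wc : (prodm mul W (c (s - k)%N) <= c (s - k.+1)%N)%VS.
    by rewrite defk; apply: WcS; rewrite -defk leq_subr.
  have i'0 : (0 < m.+1 - i)%N by rewrite subn_gt0.
  have [le_ki | lt_ik] := leqP (2 ^ k) i; last first.
    apply: subv_trans Wc; apply: prodS; first exact: powW.
    apply: IHk; first exact: ltnW.
    rewrite leq_subRL ?(ltnW lt_i) //; apply: leq_trans le_m.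
    by rewrite leq_add2r ltnW.
  apply: subv_trans Wc; apply: (@subv_trans _ _ (prodm mul (c (s - k)%N) W)).
    by apply: prodS; [apply: IHk => //; apply: ltnW | apply: powW].
  apply/prodmP => u v cu Wv; rewrite mulC.
  by have /prodmP := subvv (prodm mul W (c (s - k)%N)); apply.
exists (2 ^ s)%N; first by rewrite expn_gt0.
by have := powk s (2 ^ s)%N (leqnn s) (leqnn _); rewrite subnn c0 subv0 => /eqP.
Qed.

End Facts.

(* Main.v *)
(* Write s_i = e_i^2.  Nilpotency forces SNil(E) to annihilate every
   one-dimensional ideal, and full support puts E^2 inside SNil(E).  The
   one-dimensional abelian ideals outside ann(E) are all of the form <s_i>, and
   every copy of E_2(1,-1) comes from a class {i, j} of indices with s_i and s_j
   proportional; the point is to show that such a class has no third element.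
   - If E = Asoc_1(E) + U, then U meets SNil(E) in an ideal of E without
     one-dimensional ideals, hence trivially, so SNil(E) = Asoc_1(E) and U U = 0.
     Splitting e_i = a_i + u_i, the equations a_i e_j + a_j e_i = 0 (i <> j) and
     2 a_i e_i = e_i^2 give (s_i)_j^2 s_j = - (s_i)_i^2 s_i for all j <> i in the
     class of i, which is impossible for three indices as 2 <> 0.
   - If SNil(E)^2 = 0 and i, j, k are in one class, then suitable combinations of
     e_i, e_j and of e_i, e_k annihilate s_i, hence lie in SNil(E), but their
     product is a nonzero multiple of s_i.
   Conversely, in ann(E) + (sum of copies of E_2(1,-1)) the hyperplanes
   containing E^2 and, for each copy, the hyperplane where its two coordinates
   are opposite are maximal subalgebras, and they meet in 0. *)

Require Import Defs.
From HB Require Import structures.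
From mathcomp Require Import all_boot all_algebra.
From mathcomp Require Import boolp ring.
From mathcomp Require classical_sets.

Set Implicit Arguments.
Unset Strict Implicit.
Unset Printing Implicit Defensive.

Import GRing.Theory.

Local Open Scope ring_scope.

(** * Subalgebras, the Frattini ideal and splitting in a commutative algebra *)

Section CommutativeAlgebra.
Variables (K : fieldType) (E : vectType K) (mul : {bilinear E -> E -> E}).
Hypothesis mulC : commutative mul.
Implicit Types (A I J M N U V W : {vspace E}) (u v w x y : E).

(** The closure conditions turn Q into a subspace, so it contains the sum as soon as it contains
    every member of the family. *)
Lemma sum_of_ind (P : {vspace E} -> Prop) (Q : E -> Prop) :
    Q 0 -> (forall (a : K) u v, Q u -> Q v -> Q (a *: u + v)) ->
    (forall U u, P U -> u \in U -> Q u) ->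
  forall v, v \in sum_of P -> Q v.
Proof.
move=> Q0 QD QP v; have QE := vspace_ofP Q0 QD.
have /sum_ofP sQ : forall U, P U -> (U <= vspace_of Q)%VS.
  by move=> U PU; apply/subvP => u Uu; apply/QE; apply: QP Uu.
by move/(subvP sQ)/QE.
Qed.

Lemma eq_fullv U : (fullv <= U)%VS -> U = fullv.
Proof. by move=> sEU; apply/eqP; rewrite eqEsubv subvf. Qed.

Lemma mem_prodm U V u v : u \in U -> v \in V -> mul u v \in prodm mul U V.
Proof. by move=> Uu Vv; apply: (prodmP _ _ _ _ (subvv _)). Qed.

Lemma prodm0P U V :
  prodm mul U V = 0%VS <-> forall u v, u \in U -> v \in V -> mul u v = 0.
Proof.
split=> [UV0 u v Uu Vv | UV0].
  by apply/eqP; rewrite -memv0 -UV0 mem_prodm.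
apply/eqP; rewrite -subv0; apply/prodmP => u v Uu Vv.
by rewrite UV0 ?mem0v.
Qed.

Lemma idealMr I u v : ideal mul I -> v \in I -> mul u v \in I.
Proof. by move=> /idealP iI Iv; case: (iI u v Iv). Qed.

Lemma idealMl I u v : ideal mul I -> u \in I -> mul u v \in I.
Proof. by move=> iI Iu; rewrite mulC idealMr. Qed.

Lemma ideal_commP I : (forall u v, v \in I -> mul u v \in I) -> ideal mul I.
Proof.
by move=> iI; apply/idealP => u v Iv; rewrite [mul v u]mulC; split; apply: iI.
Qed.

Lemma ideal_cap I J : ideal mul I -> ideal mul J -> ideal mul (I :&: J).
Proof.
move=> iI iJ; apply: ideal_commP => u v; rewrite !memv_cap.
by case/andP=> Iv Jv; rewrite !idealMr.
Qed.

Lemma ideal_line w : (forall u, mul u w \in <[w]>%VS) -> ideal mul <[w]>.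
Proof.
move=> iw; apply: ideal_commP => u _ /vlineP[k ->].
by rewrite linearZr_LR memvZ.
Qed.

Lemma hyperplane_maximal M x :
    subalgebra mul M -> x \notin M -> (M + <[x]>)%VS = fullv ->
  maximal_subalgebra mul M.
Proof.
move=> aM nMx MxE; split=> [|V [aV ntV] sMV].
  by split=> // defM; rewrite defM memvf in nMx.
apply/eqP; rewrite eqEsubv sMV andbT; apply/subvP => v Vv.
(* An element of V whose x-component k is nonzero would bring x into V, making V the whole space. *)
have := memvf v; rewrite -MxE => /memv_addP[y My [_ /vlineP[k ->] def_v]].
have [k0|k0] := eqVneq k 0; first by rewrite def_v k0 scale0r addr0.
case: ntV; apply: eq_fullv; rewrite -MxE subv_add sMV -memvE.
have -> : x = k^-1 *: (v - y) by rewrite def_v addrAC subrr add0r scalerK.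
by rewrite memvZ // memvB // (subvP sMV).
Qed.

(** An element x outside E^2 is missed by some hyperplane containing E^2, and a hyperplane
    containing E^2 is a maximal subalgebra. *)
Lemma Frattini_sub_square : (Frattini mul <= prodm mul fullv fullv)%VS.
Proof.
apply/subvP => x /FrattiniP Fx; apply: contraT => nxE2.
set E2 := prodm mul fullv fullv in nxE2.
(* Together with x, this M spans E; its second summand is chosen to avoid E^2 + <x>, which keeps x
   outside M. *)
pose M := (E2 + (E2 + <[x]>)^C)%VS.
have E2C : ((E2 + <[x]>) :&: (E2 + <[x]>)^C = 0)%VS by apply: capv_compl.
have nMx : x \notin M.
  apply: contra nxE2 => /memv_addP[b Eb [c Cc def_x]].
  suff c0 : c = 0 by rewrite def_x c0 addr0.
  apply/eqP; rewrite -memv0 -E2C memv_cap Cc andbT.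
  have -> : c = - b + x by rewrite def_x addrA addNr add0r.
  by rewrite memv_add ?memvN ?memv_line.
rewrite -(negPf nMx); apply: Fx; apply: (hyperplane_maximal (x := x)) => //.
  by apply/prodmP => u v _ _; apply: (subvP (addvSl _ _)); rewrite mem_prodm ?memvf.
by rewrite /M -addvA [(_^C + _)%VS]addvC addvA addv_complf.
Qed.

(* A minimal supplement U of A meets A in an ideal lying in every maximal
   subalgebra: if M + (A :&: U) = E, then M :&: U is a smaller supplement. *)
Lemma phi_free_splits A :
  ideal mul A -> prodm mul A A = 0%VS -> phi_free mul -> splits_over mul A.
Proof.
move=> iA /prodm0P AA0 phi0.
pose Q U := subalgebra mul U /\ (A + U = fullv)%VS.
have exQ : exists k, `[< exists2 U, Q U & \dim U = k >].
  exists (\dim {:E}); apply/asboolP; exists fullv => //; split.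
    exact: subvf.
  by apply: eq_fullv; rewrite addvSr.
case: (ex_minnP exQ) => k /asboolP[U [aU AU] dU] min_k.
have minU V : Q V -> (V <= U)%VS -> V = U.
  move=> QV sVU; apply/eqP; rewrite eqEdim sVU dU; apply: min_k.
  by apply/asboolP; exists V.
exists U => //; split=> //; set B := (A :&: U)%VS.
(* Since A A = 0, only the U-component of a multiplier acts on B, and U is a subalgebra. *)
have iB : ideal mul B.
  apply: ideal_commP => u v; rewrite memv_cap => /andP[Av Uv].
  have := memvf u; rewrite -AU => /memv_addP[a Aa [b Ub ->]].
  rewrite linearDl (AA0 _ _ Aa Av) add0r memv_cap idealMr //=.
  exact: (prodmP _ _ _ _ aU).
suff sBF : (B <= Frattini mul)%VS.
  apply/eqP; rewrite -subv0 -[0%VS]phi0.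
  by have [_] := phiP mul; apply.
apply/subvP => b Bb; apply/FrattiniP => M [[aM ntM] maxM].
apply: contraT => nMb.
have aBM : subalgebra mul (B + M).
  apply/prodmP => _ _ /memv_addP[b1 B1 [m1 M1 ->]] /memv_addP[b2 B2 [m2 M2 ->]].
  rewrite linearDl [mul m1 _]linearDr; apply: memvD.
    by apply: (subvP (addvSl _ _)); rewrite idealMl.
  by apply: memv_add; [rewrite idealMr | apply: (prodmP _ _ _ _ aM)].
have BME : (B + M = fullv)%VS.
  apply/eqP; apply: contraT => /eqP ntBM.
  have BMM : (B + M)%VS = M by apply: maxM; rewrite ?addvSr.
  by rewrite -BMM (subvP (addvSl _ _)) in nMb.
(* If u = c + m with u in U, c in B and m in M, then m = u - c also lies in U. Minimality of U then
   puts U, and b with it, inside M. *)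
have defMU : (M :&: U)%VS = U.
  apply: minU (capvSr _ _); split.
    apply/prodmP => u v; rewrite !memv_cap => /andP[Mu Uu] /andP[Mv Uv].
    by rewrite (prodmP _ _ _ _ aM) // (prodmP _ _ _ _ aU).
  apply: eq_fullv; rewrite -AU subv_add addvSl; apply/subvP => u Uu.
  have := memvf u; rewrite -BME => /memv_addP[c Bc [m Mm def_u]].
  move: Bc; rewrite memv_cap => /andP[Ac Uc].
  rewrite def_u memv_add // memv_cap Mm.
  have -> : m = u - c by rewrite def_u addrAC subrr add0r.
  exact: memvB.
case/negP: nMb; move: Bb; rewrite memv_cap => /andP[_].
by rewrite -{1}defMU memv_cap => /andP[].
Qed.

(** * The supersolvable nilradical and the one-dimensional abelian ideals *)

Lemma SNil_ideal : ideal mul (SNil mul).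
Proof. by have [[]] := SNilP mulC. Qed.

(** A nilpotent ideal lowers every step of dimension at most one in a chain of ideals; here the step
    is from 0 to <w>. *)
Lemma SNil_mul_line s w : s \in SNil mul -> ideal mul <[w]> -> mul s w = 0.
Proof.
move=> Ss iw; have [[iS _ nS] _] := SNilP mulC.
have := nilpotent_chain iS nS (ideal0 mul) iw (sub0v _).
rewrite dimv0 dim_vline leq_b1 => /(_ isT)/prodmP/(_ s w Ss (memv_line w)).
by rewrite memv0 => /eqP.
Qed.

Lemma supersolvable0 : supersolvable mul 0%VS.
Proof.
exists 0%N, (fun=> 0%VS); split=> // i; rewrite leqn0 => /eqP ->.
by rewrite dimv0; split=> //; apply: ideal0.
Qed.

(** The ideal V = <w> + <x> is supersolvable through 0, <w>, V. It is nilpotent because V V lies in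
    <w> and V <w> = 0, so V^3 = 0. *)
Lemma mem_SNil w x : ideal mul <[w]> -> mul w w = 0 ->
  (forall v, mul v x \in <[w]>%VS) -> mul x w = 0 -> x \in SNil mul.
Proof.
move=> iw ww xE xw; pose V := (<[w]> + <[x]>)%VS.
have iV : ideal mul V.
  apply: ideal_commP => u _ /memv_addP[a wa [_ /vlineP[k ->] ->]].
  rewrite linearDr linearZr_LR (subvP (addvSl _ _)) //.
  by rewrite memvD ?memvZ // idealMr.
have Vw v a : v \in V -> a \in <[w]>%VS -> mul v a = 0.
  move=> /memv_addP[_ /vlineP[k ->] [_ /vlineP[l ->] ->]] /vlineP[m ->].
  by rewrite linearDl !linearZl_LR !linearZr_LR ww xw !scaler0 addr0.
have VV u v : u \in V -> v \in V -> mul u v \in <[w]>%VS.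
  move=> _ /memv_addP[a wa [_ /vlineP[l ->] ->]].
  by rewrite linearDr linearZr_LR memvD ?memvZ // idealMr.
suff sVS : (V <= SNil mul)%VS.
  by rewrite (subvP sVS) // (subvP (addvSr _ _)) ?memv_line.
have [_] := SNilP mulC; apply; split=> //.
  apply: (supersolvable_ext (U := <[w]>)) => //; last 2 first.
  - exact: addvSl.
  - apply: leq_trans (dimv_add_leqif _ _) _.
    by rewrite -addn1 leq_add2l dim_vline leq_b1.
  apply: supersolvable_ext supersolvable0 iw (sub0v _) _.
  by rewrite dimv0 dim_vline leq_b1.
have V2 : (power mul V 2 <= <[w]>)%VS.
  by rewrite powerS // big_nat1 power1; apply/prodmP.
exists 3 => //; rewrite powerS // big_nat_recr //= big_nat1 !power1.
apply/eqP; rewrite -subv0 subv_add; apply/andP; split; apply/prodmP => u v.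
  by move=> Vu /(subvP V2) wv; rewrite Vw ?mem0v.
by move=> /(subvP V2) wu Vv; rewrite mulC Vw ?mem0v.
Qed.

Lemma dim1_line J : \dim J = 1%N -> exists2 w, w != 0 & J = <[w]>%VS.
Proof.
move=> dJ; have J0 : J != 0%VS by rewrite -dimv_eq0 dJ.
exists (vpick J); first by rewrite vpick0.
apply/esym/eqP; rewrite eqEdim -memvE memv_pick dJ dim_vline.
by rewrite vpick0 J0.
Qed.

Lemma abelian_idealP J :
  abelian_ideal mul J <->
    ideal mul J /\ forall u v, u \in J -> v \in J -> mul u v = 0.
Proof.
rewrite /abelian_ideal; split=> [/andP[iJ /eqP/prodm0P] // | [iJ JJ]].
by rewrite iJ; apply/eqP/prodm0P.
Qed.

Lemma abelian_lineP w :
  abelian_ideal mul <[w]> <-> ideal mul <[w]> /\ mul w w = 0.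
Proof.
split=> [/abelian_idealP[iw ww] | [iw ww]]; first by rewrite ww ?memv_line.
apply/abelian_idealP; split=> // _ _ /vlineP[k ->] /vlineP[l ->].
by rewrite linearZl_LR linearZr_LR ww !scaler0.
Qed.

Lemma abelian_line_SNil w : abelian_ideal mul <[w]> -> w \in SNil mul.
Proof.
case/abelian_lineP=> iw ww; apply: (mem_SNil iw) => // v.
by rewrite idealMr ?memv_line.
Qed.

Lemma Asoc1_ind (Q : E -> Prop) :
    Q 0 -> (forall (a : K) u v, Q u -> Q v -> Q (a *: u + v)) ->
    (forall w, w != 0 -> abelian_ideal mul <[w]> -> Q w) ->
  forall v, v \in Asoc1 mul -> Q v.
Proof.
move=> Q0 QD Qw; apply: sum_of_ind => // U u [aU dU] Uu.
have [w w0 defU] := dim1_line dU; rewrite defU in aU Uu.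
have /vlineP[k ->] := Uu; rewrite -[k *: w]addr0.
by apply: QD; first exact: Qw.
Qed.

Lemma Asoc1_sub_SNil : (Asoc1 mul <= SNil mul)%VS.
Proof.
apply/subvP; apply: Asoc1_ind => [|a u v Su Sv|w _ /abelian_line_SNil //].
  exact: mem0v.
by rewrite memvD ?memvZ.
Qed.

Lemma mem_Asoc1 w : abelian_ideal mul <[w]> -> w \in Asoc1 mul.
Proof.
move=> aw; have [->|w0] := eqVneq w 0; first exact: mem0v.
have /sum_ofP/(_ <[w]>%VS) := subvv (Asoc1 mul).
by rewrite memvE; apply; split; rewrite ?dim_vline ?w0.
Qed.

Lemma Asoc1_ideal : ideal mul (Asoc1 mul).
Proof.
apply: ideal_commP => u; apply: Asoc1_ind => [|a x y Ax Ay|w _ aw].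
- by rewrite linear0r mem0v.
- by rewrite linearDr linearZr_LR memvD ?memvZ.
have /abelian_lineP[iw _] := aw.
have : mul u w \in <[w]>%VS by rewrite idealMr ?memv_line.
by case/vlineP=> k ->; rewrite memvZ ?mem_Asoc1.
Qed.

Lemma SNil_mul_Asoc1 s a : s \in SNil mul -> a \in Asoc1 mul -> mul s a = 0.
Proof.
move=> Ss; move: a; apply: Asoc1_ind => [|k x y sx sy|w _ /abelian_lineP[iw _]].
- by rewrite linear0r.
- by rewrite linearDr linearZr_LR sx sy scaler0 addr0.
exact: SNil_mul_line.
Qed.

Lemma Asoc1_abelian : prodm mul (Asoc1 mul) (Asoc1 mul) = 0%VS.
Proof.
by apply/prodm0P => u v /(subvP Asoc1_sub_SNil); apply: SNil_mul_Asoc1.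
Qed.

(** The first member of the supersolvable chain of SNil(E) that meets T nontrivially meets it in
    dimension one, since the preceding member has codimension one and meets T in 0. The resulting
    line is abelian because SNil(E) annihilates one-dimensional ideals. *)
Lemma SNil_sub_ideal_line T : ideal mul T -> (T <= SNil mul)%VS -> T != 0%VS ->
  exists w, [/\ w != 0, w \in T & abelian_ideal mul <[w]> ].
Proof.
move=> iT sTS T0; have [[_ [s [c [c0 cs cP cS]]] _] _] := SNilP mulC.
have exi : exists i, (i <= s)%N && ((c i :&: T)%VS != 0%VS).
  by exists s; rewrite leqnn cs (capv_idPr sTS).
case: (ex_minnP exi) => -[|i]; first by rewrite c0 cap0v eqxx andbF.
case/andP=> lt_is ciT min_i; set J := (c i.+1 :&: T)%VS in ciT.
have ciT0 : (c i :&: T = 0)%VS.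
  apply/eqP; apply: contraT => nz; have := min_i i.
  by rewrite (ltnW lt_is) nz ltnn => /(_ isT).
have [ici di] := cP i (ltnW lt_is); have [icS dS] := cP _ lt_is.
have [sc _] := cS i lt_is.
have iJ : ideal mul J by apply: ideal_cap.
have dJ : \dim J = 1%N.
  apply/eqP; rewrite eqn_leq lt0n dimv_eq0 ciT andbT.
  have := dimv_sum_cap (c i) J; rewrite /J capvA (capv_idPl sc) ciT0 dimv0 addn0.
  move=> dsum; rewrite -(leq_add2l (\dim (c i))) -dsum di addn1.
  rewrite -[X in (_ <= X)%N]dS.
  by apply: dimvS; rewrite subv_add sc /= capvSl.
have [w w0 defJ] := dim1_line dJ.
have : w \in J by rewrite defJ memv_line.
rewrite memv_cap => /andP[_ Tw]; exists w; split=> //.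
rewrite defJ in iJ; apply/abelian_lineP; split=> //.
by apply: SNil_mul_line; rewrite ?(subvP sTS).
Qed.

Lemma splits_Asoc1_SNil U : subalgebra mul U ->
    complement_of (Asoc1 mul) U ->
    (forall u v, mul u v \in SNil mul) ->
  SNil mul = Asoc1 mul /\ prodm mul U U = 0%VS.
Proof.
move=> aU [AU AU0] SE2; set A := Asoc1 mul in AU AU0 *.
have sAS : (A <= SNil mul)%VS := Asoc1_sub_SNil.
(* Asoc_1(E) annihilates SNil(E), so a multiplier acts on the intersection through its U-component
   only. *)
have iT : ideal mul (SNil mul :&: U).
  apply: ideal_commP => u v; rewrite memv_cap => /andP[Sv Uv].
  have := memvf u; rewrite -AU => /memv_addP[a Aa [b Ub ->]].
  rewrite linearDl [mul a v]mulC SNil_mul_Asoc1 // add0r memv_cap SE2.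
  exact: (prodmP _ _ _ _ aU).
(* Otherwise this ideal would contain a one-dimensional abelian ideal, lying in both Asoc_1(E) and
   U. *)
have SU0 : (SNil mul :&: U = 0)%VS.
  apply/eqP; apply: contraT => T0.
  have [w [w0 Tw aw]] := SNil_sub_ideal_line iT (capvSl _ _) T0.
  case/eqP: w0; apply/eqP; rewrite -memv0 -AU0 memv_cap mem_Asoc1 //.
  by move: Tw; rewrite memv_cap => /andP[].
split; last first.
  apply/prodm0P => u v Uu Uv; apply/eqP; rewrite -memv0 -SU0 memv_cap SE2.
  exact: (prodmP _ _ _ _ aU).
apply/eqP; rewrite eqEsubv sAS andbT; apply/subvP => s Ss.
have := memvf s; rewrite -AU => /memv_addP[a Aa [b Ub def_s]].
suff b0 : b = 0 by rewrite def_s b0 addr0.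
apply/eqP; rewrite -memv0 -SU0 memv_cap Ub andbT.
have -> : b = s - a by rewrite def_s addrAC subrr add0r.
by rewrite memvB // (subvP sAS).
Qed.

End CommutativeAlgebra.

(** * Building a sum of copies of E_2(1,-1) from elements with the right multiplication table *)

Section E2Sums.
Variables (K : fieldType) (E : vectType K) (mul : {bilinear E -> E -> E}).
Hypothesis mulC : commutative mul.
Variable m : nat.
Local Notation E2m := {ffun 'I_m -> 'rV[K]_2}.
Implicit Types (x y : E2m) (k l : 'I_m).

Lemma E2mulE (u v : 'rV[K]_2) j :
  E2mul u v 0 j = u 0 0 * v 0 0 - u 0 1 * v 0 1.
Proof.
rewrite /E2mul !mxE; have [->|->] : j = 0 \/ j = 1.
  by case: j => [[|[|]]] //= ?; [left | right]; apply/val_inj.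
all: by rewrite /= ?addr0 ?add0r mulr1 mulrN1.
Qed.

Lemma rV2P (u v : 'rV[K]_2) : u 0 0 = v 0 0 -> u 0 1 = v 0 1 -> u = v.
Proof.
move=> uv0 uv1; apply/rowP => j; have [->|->//] : j = 0 \/ j = 1.
  by case: j => [[|[|]]] //= ?; [left | right]; apply/val_inj.
by [].
Qed.

Section Construction.
Variables F G : 'I_m -> E.
Hypothesis FF : forall k l, mul (F k) (F l) = (k == l)%:R *: (F k + G k).
Hypothesis FG : forall k l, mul (F k) (G l) = 0.
Hypothesis GG : forall k l, mul (G k) (G l) = - (k == l)%:R *: (F k + G k).
Hypothesis FG0 : forall k, F k + G k != 0.

(** The map to E that sends the natural basis of the k-th copy to [F k], [G k]. *)
Let comb x := \sum_k (x k 0 0 *: F k + x k 0 1 *: G k).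

Let comb_linear : linear comb.
Proof.
move=> a x y; rewrite /comb scaler_sumr -big_split; apply: eq_bigr => k _ /=.
by rewrite !ffunE !mxE !scalerDl scalerDr !scalerA addrACA.
Qed.

HB.instance Definition _ := GRing.isLinear.Build K E2m E *:%R comb comb_linear.

Let mulF k y : mul (F k) (comb y) = y k 0 0 *: (F k + G k).
Proof.
rewrite linear_sumr (bigD1 k) //= big1 ?addr0 => [|l lk].
  by rewrite linearDr !linearZr_LR FF FG scaler0 addr0 eqxx scale1r.
by rewrite linearDr !linearZr_LR FF FG eq_sym (negPf lk) scale0r !scaler0 addr0.
Qed.

Let mulG k y : mul (G k) (comb y) = - y k 0 1 *: (F k + G k).
Proof.
rewrite linear_sumr (bigD1 k) //= big1 ?addr0 => [|l lk].
  rewrite linearDr !linearZr_LR [mul _ (F k)]mulC FG scaler0 add0r GG eqxx.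
  by rewrite scaleNr scale1r scalerN scaleNr.
rewrite linearDr !linearZr_LR [mul _ (F l)]mulC FG GG eq_sym (negPf lk).
by rewrite oppr0 scale0r !scaler0 addr0.
Qed.

Let comb_mul x y : comb [ffun k => E2mul (x k) (y k)] = mul (comb x) (comb y).
Proof.
rewrite {2}/comb linear_sumlz; apply: eq_bigr => k _.
rewrite ffunE !E2mulE -scalerDr linearDl !linearZl_LR mulF mulG !scalerA.
by rewrite -scalerDl mulrN.
Qed.

(** Multiplying by [F k] and [G k] reads off, up to sign, the two coordinates of the k-th copy. This
    yields both the injectivity of [comb] and the trivial intersection of its image with ann(E). *)
Let comb_ann x : comb x \in ann mul -> x = 0.
Proof.
move=> /annP ax; apply/ffunP => k; rewrite ffunE; apply: rV2P; rewrite mxE.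
  have := ax (F k); rewrite mulC mulF => /eqP.
  by rewrite scaler_eq0 (negPf (FG0 k)) orbF => /eqP.
have := ax (G k); rewrite mulC mulG => /eqP.
by rewrite scaler_eq0 (negPf (FG0 k)) orbF oppr_eq0 => /eqP.
Qed.

Let comb_delta k (u : 'rV[K]_2) :
  comb [ffun j => (j == k)%:R *: u] = u 0 0 *: F k + u 0 1 *: G k.
Proof.
rewrite /comb (bigD1 k) //= big1 ?addr0 => [|l /negPf lk].
  by rewrite ffunE eqxx scale1r.
by rewrite ffunE lk scale0r !mxE !scale0r addr0.
Qed.

(** The condition on V says that ann(E) and the elements [F k], [G k] span E; it is applied to V =
    ann(E) + image. The dimension bound is injectivity. *)
Lemma E2_sum_complement :
    (forall V : {vspace E}, (ann mul <= V)%VS ->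
       (forall k, F k \in V /\ G k \in V) -> V = fullv) ->
  (m * 2 <= \dim {:E})%N /\ exists U : {vspace E},
    [/\ subalgebra mul U, complement_of (ann mul) U & iso_E2_sum mul m U].
Proof.
move=> genE; pose f := linfun comb; have fE x : f x = comb x by rewrite lfunE.
have kerf : lker f = 0%VS.
  apply/eqP; rewrite -subv0; apply/subvP => x.
  rewrite memv_ker fE memv0 => /eqP x0.
  by apply/eqP/comb_ann; rewrite x0 mem0v.
have mem_f x : comb x \in limg f by rewrite -fE memv_img ?memvf.
split.
  have <- : \dim (limg f) = (m * 2)%N.
    by rewrite limg_dim_eq ?kerf ?capv0 // dimvf /dim /= card_ord.
  exact/dimvS/subvf.
exists (limg f); split; last by exists f; split=> // x y; rewrite !fE comb_mul.
  apply/prodmP => _ _ /memv_imgP[x _ ->] /memv_imgP[y _ ->].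
  by rewrite !fE -comb_mul.
split.
  apply: genE => [|k]; first exact: addvSl.
  split; apply: (subvP (addvSr _ _)).
    have := mem_f [ffun j => (j == k)%:R *: delta_mx 0 0].
    by rewrite comb_delta !mxE /= scale1r scale0r addr0.
  have := mem_f [ffun j => (j == k)%:R *: delta_mx 0 1].
  by rewrite comb_delta !mxE /= scale1r scale0r add0r.
apply/eqP; rewrite -subv0; apply/subvP => v; rewrite memv_cap.
case/andP=> av /memv_imgP[x _ def_v]; move: av; rewrite def_v fE.
by move/comb_ann ->; rewrite linear0 mem0v.
Qed.

End Construction.

End E2Sums.

(** * Consequences of a decomposition of E into ann(E) and copies of E_2(1,-1) *)

Section Decomposition.
Variables (K : fieldType) (E : vectType K) (mul : {bilinear E -> E -> E}).
Hypothesis mulC : commutative mul.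
Variables (m : nat) (U : {vspace E}).
Hypothesis annU : complement_of (ann mul) U.
Local Notation E2m := {ffun 'I_m -> 'rV[K]_2}.
Implicit Types (x y : E2m) (k l : 'I_m) (u v w : E).
Variable f : 'Hom(E2m, E).
Hypothesis kerf : lker f = 0%VS.
Hypothesis imf : limg f = U.
Hypothesis fM : forall x y, f [ffun i => E2mul (x i) (y i)] = mul (f x) (f y).

Let dec v : exists a y, a \in ann mul /\ v = a + f y.
Proof.
have := memvf v; rewrite -annU.1 -imf => /memv_addP[a aa [_ /memv_imgP[y _ ->] ->]].
by exists a, y.
Qed.

Let dec_inj a b x y :
  a \in ann mul -> b \in ann mul -> a + f x = b + f y -> a = b /\ x = y.
Proof.
move=> aa ab eq_ab; have fxy : f (x - y) = b - a.
  by apply/eqP; rewrite linearB /= subr_eq addrAC -eq_ab addrAC subrr add0r.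
have: f (x - y) \in (ann mul :&: U)%VS.
  by rewrite memv_cap -imf memv_img ?memvf // fxy memvB.
rewrite annU.2 memv0 => /eqP fxy0; split.
  by apply/esym/eqP; rewrite -subr_eq0 -fxy fxy0.
by apply/eqP; rewrite -subr_eq0 -memv0 -kerf memv_ker fxy0.
Qed.

Let decM a b x y : a \in ann mul -> b \in ann mul ->
  mul (a + f x) (b + f y) = f [ffun i => E2mul (x i) (y i)].
Proof.
move=> /annP aa /annP ab; rewrite linearDl aa add0r linearDr mulC ab add0r.
by rewrite fM.
Qed.

(** The element e_1 + e_2 of the k-th copy; its image [h k] spans the square of that copy, a
    one-dimensional abelian ideal of E. *)
Let d k : E2m := [ffun j => (j == k)%:R *: const_mx 1].
Let h k := f (d k).

Let dE k j i : d k j 0 i = (j == k)%:R.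
Proof. by rewrite ffunE !mxE mulr1. Qed.

Let mul_h a y k : a \in ann mul ->
  mul (a + f y) (h k) = (y k 0 0 - y k 0 1) *: h k.
Proof.
move=> aa; rewrite -[h k]add0r decM ?mem0v // add0r -linearZ; congr (f _).
apply/ffunP => j; apply/rowP => i; rewrite !ffunE E2mulE !mxE.
by have [->|] := eqVneq j k; rewrite ?mulr1 // !mulr0 subrr.
Qed.

Let h_neq0 k : h k != 0.
Proof.
rewrite -memv_ker kerf memv0; apply/eqP => /ffunP/(_ k)/rowP/(_ 0).
by rewrite dE ffunE mxE eqxx => /eqP; rewrite oner_eq0.
Qed.

Let abelian_h k : abelian_ideal mul <[h k]>.
Proof.
apply/(abelian_lineP mul); split.
  apply: ideal_line => // v; have [a [y [aa ->]]] := dec v.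
  by rewrite mul_h // memvZ ?memv_line.
by rewrite -{1}[h k]add0r mul_h ?mem0v // !dE subrr scale0r.
Qed.

Let h_nann k : h k \notin ann mul.
Proof.
pose y : E2m := [ffun j => (j == k)%:R *: delta_mx 0 0].
apply/negP => /annP/(_ (0 + f y)); rewrite mulC mul_h ?mem0v //.
rewrite ffunE !mxE eqxx !mulr1 mulr0 subr0 scale1r => /eqP.
by rewrite (negPf (h_neq0 k)).
Qed.

Let sum_h y : (forall k, y k 0 0 = y k 0 1) -> f y = \sum_k y k 0 0 *: h k.
Proof.
move=> y01; under eq_bigr do rewrite -linearZ.
rewrite -linear_sum; congr (f _); apply/ffunP => j.
rewrite sum_ffunE (bigD1 j) //= big1 ?addr0 => [|k /negPf kj]; last first.
  by rewrite !ffunE eq_sym kj scale0r scaler0.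
by apply: rV2P; rewrite !ffunE !mxE eqxx !mulr1.
Qed.

(** SNil(E) annihilates the ideal <h_k>, whereas s acts on h_k as the difference of its two
    coordinates in the k-th copy. *)
Let SNil_dec s : s \in SNil mul ->
  exists a y, [/\ a \in ann mul, s = a + f y & forall k, y k 0 0 = y k 0 1].
Proof.
move=> Ss; have [a [y [aa def_s]]] := dec s; exists a, y; split=> // k.
have [ih _] := (abelian_lineP mul _).1 (abelian_h k).
have := SNil_mul_line mulC Ss ih; rewrite def_s mul_h // => /eqP.
by rewrite scaler_eq0 (negPf (h_neq0 k)) orbF subr_eq0 => /eqP.
Qed.

Lemma E2_decomposition_SNil_square : prodm mul (SNil mul) (SNil mul) = 0%VS.
Proof.
apply/prodm0P => u v /SNil_dec[a [x [aa -> x01]]] /SNil_dec[b [y [ab -> y01]]].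
rewrite decM //; have -> : [ffun i => E2mul (x i) (y i)] = 0.
  by apply/ffunP => i; apply/rowP => j; rewrite !ffunE E2mulE mxE x01 y01 subrr.
exact: linear0.
Qed.

(** With equal coordinates in each copy, an element of SNil(E) is a combination of the h_k modulo
    ann(E), and the lines <h_k> are abelian ideals outside ann(E). *)
Lemma E2_decomposition_SNil_sub (V : {vspace E}) : (ann mul <= V)%VS ->
    (forall w, abelian_ideal mul <[w]> -> w \notin ann mul -> w \in V) ->
  (SNil mul <= V)%VS.
Proof.
move=> /subvP annV lineV; apply/subvP => _ /SNil_dec[a [y [aa -> y01]]].
rewrite memvD ?(annV a aa) // sum_h // memv_suml // => k _.
by apply/memvZ/lineV.
Qed.

Lemma E2_decomposition_phi_free : 2%N \notin [pchar K] -> phi_free mul.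
Proof.
rewrite inE /= => two; apply/eqP; rewrite -subv0.
apply: subv_trans (phiP mul).1.2 _; apply/subvP => v Fv.
(* A subspace containing E^2, hence the Frattini subalgebra: a product in E_2(1,-1) has equal
   coordinates. *)
pose Q2 u := exists2 y, u = f y & forall k, y k 0 0 = y k 0 1.
have Q2P : forall u, u \in vspace_of Q2 <-> Q2 u.
  apply: vspace_ofP => [|a _ _ [x -> x01] [y -> y01]].
    by exists 0 => [|k]; rewrite ?linear0 // !ffunE !mxE.
  by exists (a *: x + y) => [|k]; rewrite ?linearP // !ffunE !mxE x01 y01.
have sE2 : (prodm mul fullv fullv <= vspace_of Q2)%VS.
  apply/prodmP => u w _ _; apply/Q2P.
  have [a [x [aa ->]]] := dec u; have [b [y [ab ->]]] := dec w.
  rewrite decM //; exists [ffun i => E2mul (x i) (y i)] => // k.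
  by rewrite !ffunE !E2mulE.
have /Q2P[y def_v y01] := subvP (subv_trans (Frattini_sub_square mul) sE2) v Fv.
suff y0 : y = 0 by rewrite def_v y0 linear0 mem0v.
suff y00 k : y k 0 0 = 0.
  by apply/ffunP => k; apply: rV2P; rewrite -?y01 y00 ffunE mxE.
(* The hyperplane of opposite coordinates in the k-th copy. Two of its elements have a product with
   zero component there, so it is a subalgebra, and maximal. Equal and opposite coordinates vanish
   since 2 is invertible. *)
pose Q u := exists a y, [/\ a \in ann mul, u = a + f y & y k 0 0 + y k 0 1 = 0].
have QP : forall u, u \in vspace_of Q <-> Q u.
  apply: vspace_ofP => [|c _ _ [a [x [aa -> x01]]] [b [z [ab -> z01]]]].
    by exists 0, 0; rewrite mem0v !ffunE !mxE linear0 !addr0.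
  exists (c *: a + b), (c *: x + z); rewrite memvD ?memvZ //; split=> //.
    by rewrite linearP /= scalerDr addrACA.
  by rewrite !ffunE !mxE addrACA -mulrDr x01 z01 mulr0 addr0.
have maxQ : maximal_subalgebra mul (vspace_of Q).
  apply: (hyperplane_maximal (x := h k)).
  - apply/prodmP => _ _ /QP[a [x [aa -> x01]]] /QP[b [z [ab -> z01]]].
    apply/QP; exists 0, [ffun i => E2mul (x i) (z i)].
    rewrite mem0v decM // add0r; split=> //; rewrite !ffunE !E2mulE.
    move/eqP: x01; rewrite addr_eq0 => /eqP ->.
    move/eqP: z01; rewrite addr_eq0 => /eqP ->.
    by rewrite mulrNN subrr addr0.
  - apply/negP => /QP[a [z [aa hE]]].
    have [_ <-] : 0 = a /\ d k = z by apply: dec_inj; rewrite ?mem0v // add0r.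
    by rewrite !dE eqxx => /eqP; rewrite -mulr2n (negPf two).
  apply: eq_fullv; apply/subvP => u _; have [a [z [aa ->]]] := dec u.
  (* Half the coordinate sum, because the coordinates of h_k add up to 2. *)
  pose c := (z k 0 0 + z k 0 1) / 2%:R.
  have -> : a + f z = (a + f (z - c *: d k)) + c *: h k.
    by rewrite linearB linearZ /= addrA subrK.
  apply: memv_add; last by rewrite memvZ ?memv_line.
  apply/QP; exists a, (z - c *: d k); split=> //.
  have zE i : (z - c *: d k) k 0 i = z k 0 i - c.
    by rewrite !ffunE !mxE eqxx !mulr1.
  by rewrite !zE /c; field.
have /QP[a [z [aa def_v' z01]]] := (FrattiniP mul v).1 Fv _ maxQ.
have [_ eq_yz] : 0 = a /\ y = z.
  by apply: dec_inj; rewrite ?mem0v // add0r -def_v.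
move: z01; rewrite -eq_yz -y01 => /eqP.
by rewrite -mulr2n -mulr_natl mulf_eq0 (negPf two) => /eqP.
Qed.

End Decomposition.

(** * Coordinates in a natural basis, supports and one-dimensional ideals *)

Section NaturalBasis.
Variables (K : fieldType) (E : vectType K) (mul : {bilinear E -> E -> E}).
Variables (n : nat) (e : n.-tuple E).
Hypothesis e_natural : natural_basis mul e.
Implicit Types (A I J M N U V W : {vspace E}) (u v w x y : E) (i j k : 'I_n).

Let mulC : commutative mul := natural_basis_mulC e_natural.

Local Notation sq i := (mul e`_i e`_i).

Lemma sum_coord x : x = \sum_i coord e i x *: e`_i.
Proof. by case: e_natural => /coord_basis eE _; apply: eE; apply: memvf. Qed.

Lemma coord_natural i j : coord e i e`_j = (i == j)%:R.
Proof. by case: e_natural => /basis_free fe _; rewrite coord_free // eq_sym. Qed.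

Lemma mul_basis x i : mul x e`_i = coord e i x *: sq i.
Proof.
rewrite {1}[x]sum_coord linear_sumlz (bigD1 i) //= linearZl_LR big1 ?addr0 //.
by move=> j ji; rewrite linearZl_LR (e_natural.2 _ _ ji) scaler0.
Qed.

Lemma mulE x y : mul x y = \sum_i (coord e i x * coord e i y) *: sq i.
Proof.
rewrite {1}[y]sum_coord linear_sumr; apply: eq_bigr => i _.
by rewrite linearZr_LR mul_basis scalerA mulrC.
Qed.

Lemma mul_mem V x y :
  (forall i, coord e i x != 0 -> coord e i y != 0 -> sq i \in V) -> mul x y \in V.
Proof.
move=> sqV; rewrite mulE memv_suml // => i _.
have [->|x0] := eqVneq (coord e i x) 0; first by rewrite mul0r scale0r mem0v.
have [->|y0] := eqVneq (coord e i y) 0; first by rewrite mulr0 scale0r mem0v.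
by rewrite memvZ ?sqV.
Qed.

Lemma ann_basis i : sq i = 0 -> e`_i \in ann mul.
Proof. by move=> s0; apply/annP => v; rewrite mulC mul_basis s0 scaler0. Qed.

Lemma mul_ann x y : x \in ann mul -> mul y x = 0.
Proof. by rewrite mulC => /annP. Qed.

Lemma coord_ann x i : sq i != 0 -> x \in ann mul -> coord e i x = 0.
Proof.
move=> s0 /annP/(_ e`_i)/eqP; rewrite mul_basis scaler_eq0 (negPf s0) orbF.
exact: eqP.
Qed.

Lemma mem_suppv V i : i \in suppv e V <-> exists2 v, v \in V & coord e i v != 0.
Proof.
rewrite inE; split=> [/asboolP[v Vv]|[v Vv ci]]; first by rewrite inE; exists v.
by apply/asboolP; exists v; rewrite ?inE.
Qed.

(** If x in V has nonzero i-th coordinate, then x e_i is a nonzero multiple of e_i^2, so V contains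
    every e_i^2; these squares span E^2. *)
Lemma full_supp_square V : ideal mul V -> suppv e V = suppv e fullv ->
  forall u v, mul u v \in V.
Proof.
move=> iV suppV u v; apply: mul_mem => i _ _.
have : i \in suppv e V.
  rewrite suppV; apply/mem_suppv; exists e`_i; first exact: memvf.
  by rewrite coord_natural eqxx oner_eq0.
case/mem_suppv=> x Vx xi; have -> : sq i = (coord e i x)^-1 *: mul x e`_i.
  by rewrite (mul_basis x) scalerA mulVf // scale1r.
by rewrite memvZ // (idealMl mulC).
Qed.

Lemma sq_line w i : ideal mul <[w]> -> coord e i w != 0 -> sq i \in <[w]>%VS.
Proof.
move=> iw wi; have -> : sq i = (coord e i w)^-1 *: mul w e`_i.
  by rewrite (mul_basis w) scalerA mulVf // scale1r.
by rewrite memvZ // (idealMl mulC) ?memv_line.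
Qed.

Lemma line_eq_sq w i : ideal mul <[w]> -> coord e i w != 0 -> sq i != 0 ->
  <[w]>%VS = <[sq i]>%VS.
Proof.
move=> iw wi s0; have ws := sq_line iw wi.
apply/esym/eqP; rewrite eqEdim -memvE ws !dim_vline s0.
exact: leq_b1.
Qed.

Lemma supp_Asoc1 i : i \in suppv e (Asoc1 mul) ->
  exists2 w, abelian_ideal mul <[w]> & coord e i w != 0.
Proof.
case/mem_suppv=> v Av; move: v Av.
apply: (Asoc1_ind (Q := fun v => coord e i v != 0 -> _)) => [|a u v Qu Qv|].
- by rewrite linear0 eqxx.
- rewrite linearP /=; have [->|/Qu //] := eqVneq (coord e i u) 0.
  by rewrite mulr0 add0r.
by move=> w _ aw wi; exists w.
Qed.

Lemma mem_supp_ideal w x :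
  x \in supp_ideal e w <-> forall i, coord e i w = 0 -> coord e i x = 0.
Proof.
split=> [/memv_sumP[f fw ->] i wi | wx].
  rewrite linear_sum big1 // => k; rewrite inE => wk.
  have /vlineP[a ->] : f k \in <[e`_k]>%VS by apply: fw; rewrite inE.
  rewrite linearZ /= coord_natural; have [ik|] := eqVneq i k; last by rewrite mulr0.
  by rewrite -ik wi eqxx in wk.
rewrite [x]sum_coord (bigID (mem (supp e w))) /= addrC big1 ?add0r.
  by apply: memv_sumr => k _; apply: memvZ; apply: memv_line.
by move=> k; rewrite inE negbK => /eqP/wx ->; rewrite scale0r.
Qed.

Lemma mul_supp_ideal w x v : ideal mul <[w]> -> x \in supp_ideal e w ->
  mul v x \in <[w]>%VS.
Proof.
move=> iw /mem_supp_ideal wx; apply: mul_mem => i _ xi; apply: sq_line => //.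
by apply: contra xi => /eqP/wx ->.
Qed.

(** * The ideals Nil(E_J) and N^1(E) *)

Lemma NilP A :
  is_maximal (fun N => ideal_of mul A N /\ nilpotent mul N) (Defs.Nil mul A).
Proof.
apply: classical_sets.xgetPex; set P := fun N => _; have P0 : P 0%VS.
  split; last by exists 1%N.
  apply/and3P; split; first exact: sub0v.
    by apply/prodmP => u v _; rewrite memv0 => /eqP ->; rewrite linear0r mem0v.
  by apply/prodmP => u v; rewrite memv0 => /eqP -> _; rewrite linear0l mem0v.
have [N PN maxN] := ex_max_dim (P := P) P0; exists N; split=> // V PV sNV.
by apply/esym/eqP; rewrite eqEdim sNV maxN.
Qed.

Lemma Nil_sub A : (Defs.Nil mul A <= A)%VS.
Proof. by have [[/and3P[]]] := NilP A. Qed.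

(** If w were outside N = Nil(A), then N and <w> would meet in 0, while products with elements of A
    lie in <w>. This forces N N = N w = 0, so N + <w> has zero square, against the maximality of
    N. *)
Lemma mem_Nil_supp_ideal w : abelian_ideal mul <[w]> ->
  w \in Defs.Nil mul (supp_ideal e w).
Proof.
move=> /abelian_lineP[iw ww]; set A := supp_ideal e w.
have [[iN nN] maxN] := NilP A; set N := Defs.Nil mul A in iN nN maxN *.
have /and3P[/subvP sNA AN _] := iN.
have Aw : w \in A by apply/mem_supp_ideal.
apply: contraT => nNw; pose V := (N + <[w]>)%VS.
have sVA : (V <= A)%VS by rewrite subv_add -memvE Aw andbT; apply/subvP.
have AV u v : v \in V -> mul u v \in <[w]>%VS.
  by move=> /(subvP sVA); apply: mul_supp_ideal.
have cap0 x : x \in N -> x \in <[w]>%VS -> x = 0.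
  move=> Nx /vlineP[k def_x]; have [k0|k0] := eqVneq k 0.
    by rewrite def_x k0 scale0r.
  by move: nNw; rewrite -[w](scalerK k0) -def_x memvZ.
have Nw x : x \in N -> mul x w = 0.
  move=> Nx; apply: cap0; last by rewrite AV // (subvP (addvSr _ _)) ?memv_line.
  by rewrite mulC (prodmP _ _ _ _ AN).
have NN x y : x \in N -> y \in N -> mul x y = 0.
  move=> Nx Ny; apply: cap0; first by rewrite (prodmP _ _ _ _ AN) ?sNA.
  by rewrite AV // (subvP (addvSl _ _)).
have VV : prodm mul V V = 0%VS.
  apply/prodm0P => u v /memv_addP[x Nx [_ /vlineP[k ->] ->]].
  case/memv_addP=> y Ny [_ /vlineP[l ->] ->].
  rewrite linearDl !linearDr !linearZl_LR !linearZr_LR NN // Nw // mulC Nw // ww.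
  by rewrite !scaler0 !addr0.
have defV : V = N.
  apply: maxN; last exact: addvSl.
  split; last by exists 2%N => //; rewrite powerS // big_nat1 power1.
  have swV : (<[w]> <= V)%VS := addvSr _ _.
  apply/and3P; split=> //; apply/prodmP => u v.
    by move=> _ Vv; rewrite (subvP swV) ?AV.
  by move=> Vu _; rewrite mulC (subvP swV) ?AV.
by rewrite -defV (subvP (addvSr _ _)) ?memv_line in nNw.
Qed.

(** An element x of the nilpotent ideal sends w to k w. If k were nonzero, w = k^-1 (x w) would lie
    in every power of that ideal; hence x w = 0 and [mem_SNil] applies. *)
Lemma Nil_supp_ideal_sub_SNil w : abelian_ideal mul <[w]> -> w != 0 ->
  (Defs.Nil mul (supp_ideal e w) <= SNil mul)%VS.
Proof.
move=> aw w0; have [iw ww] := (abelian_lineP mul w).1 aw.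
have Nw := mem_Nil_supp_ideal aw; have [[_ nN] _] := NilP (supp_ideal e w).
set N := Defs.Nil _ _ in Nw nN *; apply/subvP => x Nx.
have Ax : x \in supp_ideal e w by apply: (subvP (Nil_sub _)).
apply: (mem_SNil mulC iw ww) => [v|]; first exact: mul_supp_ideal.
have /vlineP[k xw] : mul x w \in <[w]>%VS by rewrite idealMr ?memv_line.
have [k0|k0] := eqVneq k 0; first by rewrite xw k0 scale0r.
case: nN => m m0 Nm; case/eqP: w0; apply/eqP; rewrite -memv0 -Nm.
elim: m m0 {Nm} => // -[_ _|m IHm _]; first by rewrite power1.
rewrite powerS // big_ltn // subn1 power1 -[w](scalerK k0) -xw.
by apply/memvZ/(subvP (addvSl _ _))/mem_prodm => //; apply: IHm.
Qed.

Lemma ann_sub_SNil : (ann mul <= SNil mul)%VS.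
Proof.
apply/subvP => x ax.
have i0 : ideal mul <[0]> by apply: ideal_line => // u; rewrite linear0r mem0v.
apply: (mem_SNil mulC i0); rewrite ?linear0r //.
by move=> v; rewrite mul_ann ?mem0v.
Qed.

Lemma N1_sub_SNil : (N1 mul e <= SNil mul)%VS.
Proof.
rewrite subv_add ann_sub_SNil andbT; apply/sum_ofP => _ [w [aw dw _ ->]].
apply: Nil_supp_ideal_sub_SNil => //.
by move: dw; rewrite dim_vline; case: eqP.
Qed.

Lemma mem_N1 w : abelian_ideal mul <[w]> -> w \notin ann mul -> w \in N1 mul e.
Proof.
move=> aw nw; apply: (subvP (addvSl _ _)).
have w0 : w != 0 by apply: contra nw => /eqP ->; rewrite mem0v.
apply/sum_ofE; exists [:: Defs.Nil mul (supp_ideal e w)] => [U|]; last first.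
  by rewrite big_seq1 mem_Nil_supp_ideal.
by rewrite inE => /eqP ->; exists w; split; rewrite ?dim_vline ?w0 -?memvE.
Qed.

(** Elements of ann(E) have zero i-th coordinate when e_i^2 is nonzero, and Nil(E_J) lies in E_J,
    whose support is that of J. *)
Lemma supp_N1 i : sq i != 0 -> i \in suppv e (N1 mul e) ->
  exists2 w, abelian_ideal mul <[w]> & coord e i w != 0.
Proof.
move=> s0 /mem_suppv[_ /memv_addP[v Nv [z az ->]]].
rewrite linearD /= (coord_ann s0 az) addr0; move: v Nv {z az}.
apply: (sum_of_ind (Q := fun v => coord e i v != 0 -> _)) => [|a u v Qu Qv|].
- by rewrite linear0 eqxx.
- rewrite linearP /=; have [->|/Qu //] := eqVneq (coord e i u) 0.
  by rewrite mulr0 add0r.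
move=> _ u [w [aw _ _ ->]] /(subvP (Nil_sub _))/mem_supp_ideal wu ui.
by exists w => //; apply: contra ui => /eqP/wu ->.
Qed.

Lemma size_natural : n = \dim {:E}.
Proof. by case: e_natural => /size_basis. Qed.

Lemma mem_annP z : (forall k, sq k != 0 -> coord e k z = 0) -> z \in ann mul.
Proof.
move=> z0; apply/annP => v; apply/eqP; rewrite -memv0; apply: mul_mem => k zk _.
by rewrite memv0; apply: contraR zk => /z0 ->.
Qed.

(** * Pairing the indices of nonzero square, and the resulting copies of E_2(1,-1) *)

Section Pairing.
Hypothesis lines : forall i, sq i != 0 ->
  exists2 w, abelian_ideal mul <[w]> & coord e i w != 0.

(** A one-dimensional ideal <w> with i in the support of w contains e_i^2, so it equals <e_i^2>. *)
Lemma sq_abelian_line i : sq i != 0 ->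
  abelian_ideal mul <[sq i]> /\ coord e i (sq i) != 0.
Proof.
move=> s0; have [w aw wi] := lines s0; have [iw _] := (abelian_lineP mul w).1 aw.
have def_w := line_eq_sq iw wi s0; rewrite -def_w; split=> //.
have /vlineP[k def_s] : sq i \in <[w]>%VS by apply: sq_line.
rewrite def_s linearZ /= mulf_neq0 //.
by apply: contra s0 => /eqP k0; rewrite def_s k0 scale0r.
Qed.

Lemma sq_proportional i j : sq i != 0 -> sq j != 0 -> coord e j (sq i) != 0 ->
  exists2 t, t != 0 & sq j = t *: sq i.
Proof.
move=> si sj cij; have [/(abelian_lineP mul)[li _] _] := sq_abelian_line si.
have /vlineP[t def_sj] := sq_line li cij; exists t => //.
by apply: contra sj => /eqP t0; rewrite def_sj t0 scale0r.
Qed.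

Lemma coord_sq_sym i j : sq i != 0 -> sq j != 0 -> coord e j (sq i) != 0 ->
  coord e i (sq j) != 0.
Proof.
move=> si sj cij; have [t t0 ->] := sq_proportional si sj cij.
by rewrite linearZ /= mulf_neq0 //; have [] := sq_abelian_line si.
Qed.

Lemma sq_sq i : sq i != 0 -> \sum_j coord e j (sq i) ^+ 2 *: sq j = 0.
Proof.
move=> si; have [/(abelian_lineP mul)[_ sisi] _] := sq_abelian_line si.
by rewrite -[RHS]sisi [RHS]mulE; apply: eq_bigr => j _; rewrite expr2.
Qed.

Hypothesis pairs : forall i j k, sq i != 0 -> sq j != 0 -> sq k != 0 ->
  i != j -> i != k -> j != k ->
  coord e j (sq i) != 0 -> coord e k (sq i) != 0 -> False.

Let partner i j := [&& j != i, sq j != 0 & coord e j (sq i) != 0].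

(** The default value i is never taken when [sq i] is nonzero; [pairs] makes the choice unique. *)
Let mate i := odflt i [pick j | partner i j].

Let mateP i : sq i != 0 -> partner i (mate i).
Proof.
move=> si; rewrite /mate; case: pickP => //= no_mate.
(* Without a partner, the relation s_i s_i = 0 reduces to its i-th term, which is nonzero. *)
have [_ sii] := sq_abelian_line si.
have := sq_sq si; rewrite (bigD1 i) //= big1 ?addr0 => [/eqP|j ji].
  by rewrite scaler_eq0 sqrf_eq0 (negPf sii) (negPf si).
have [->|sj] := eqVneq (sq j) 0; first by rewrite scaler0.
have := no_mate j; rewrite /partner ji sj /= => /negbFE/eqP ->.
by rewrite expr0n scale0r.
Qed.

Let mate_uniq i j : sq i != 0 -> partner i j -> j = mate i.
Proof.
move=> si /and3P[ji sj cij]; have /and3P[mi sm cim] := mateP si.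
apply/eqP; apply: contraT => jm.
by case: (pairs si sj sm _ _ jm cij cim); rewrite eq_sym.
Qed.

Let mate_neq i : sq i != 0 -> mate i != i.
Proof. by move=> /mateP/and3P[]. Qed.

Let sq_mate i : sq i != 0 -> sq (mate i) != 0.
Proof. by move=> /mateP/and3P[]. Qed.

Let mateK i : sq i != 0 -> mate (mate i) = i.
Proof.
move=> si; have /and3P[mi sm cim] := mateP si.
apply/esym/mate_uniq => //; rewrite /partner eq_sym mi si.
exact: coord_sq_sym.
Qed.

Let p i : K := coord e i (sq i).
Let q i : K := coord e (mate i) (sq i).

Let p0 i : sq i != 0 -> p i != 0. Proof. by case/sq_abelian_line. Qed.
Let q0 i : sq i != 0 -> q i != 0. Proof. by case/mateP/and3P. Qed.

(** Uniqueness of the mate leaves only the terms of i and [mate i] in the relation s_i s_i = 0. *)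
Let sq_mateE i : sq i != 0 -> sq (mate i) = - (p i ^+ 2 / q i ^+ 2) *: sq i.
Proof.
move=> si; have := sq_sq si; rewrite (bigD1 i) //= (bigD1 (mate i)) ?mate_neq //=.
rewrite big1 ?addr0 => [/eqP|j /andP[ji jm]].
  rewrite addr_eq0 => /eqP/(congr1 (fun v => - (q i ^+ 2)^-1 *: v)) eq_sq.
  have qq : q i ^+ 2 != 0 by rewrite expf_neq0 ?q0.
  move: eq_sq; rewrite -scaleNr !scalerA mulrNN mulVf // scale1r => <-.
  by rewrite mulNr mulrC.
have [->|sj] := eqVneq (sq j) 0; first by rewrite scaler0.
have [->|cij] := eqVneq (coord e j (sq i)) 0; first by rewrite expr0n scale0r.
have ij : partner i j by rewrite /partner ji sj.
by rewrite -(mate_uniq si ij) eqxx in jm.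
Qed.

(* Up to ann(E), s_i = p e_i + q e_(mate i); the remainder goes into F_i, and the
   scaling makes F_i^2 = F_i + G_i hold on the nose. *)
Let F i := (p i ^+ 2)^-1 *: (sq i - q i *: e`_(mate i)).
Let G i := ((p i ^+ 2)^-1 * q i) *: e`_(mate i).

Let FGE i : F i + G i = (p i ^+ 2)^-1 *: sq i.
Proof. by rewrite /F /G scalerBr scalerA subrK. Qed.

Let coordG i k : coord e k (G i) = (p i ^+ 2)^-1 * q i * (k == mate i)%:R.
Proof. by rewrite linearZ /= coord_natural. Qed.

(** Modulo ann(E), F_i is p_i^-1 e_i: the coordinate at [mate i] was subtracted, and any other index
    k of nonzero square is absent from s_i by uniqueness of the mate. *)
Let coordF i k : sq i != 0 -> sq k != 0 ->
  coord e k (F i) = (p i)^-1 * (k == i)%:R.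
Proof.
move=> si sk; rewrite linearZ /= linearB linearZ /= coord_natural.
have [->|ki] := eqVneq k i.
  rewrite eq_sym (negPf (mate_neq si)) mulr0 subr0 mulr1 -/(p i).
  by field; rewrite p0.
have [->|km] := eqVneq k (mate i); first by rewrite mulr1 subrr !mulr0.
rewrite !mulr0 subr0; have [->|cik] := eqVneq (coord e k (sq i)) 0.
  exact: mulr0.
have ik : partner i k by rewrite /partner ki sk.
by rewrite -(mate_uniq si ik) eqxx in km.
Qed.

Let mulF i v : sq i != 0 -> mul (F i) v = ((p i)^-1 * coord e i v) *: sq i.
Proof.
move=> si; rewrite [LHS]mulE (bigD1 i) //= coordF // eqxx mulr1 big1 ?addr0 //.
move=> k ki; have [->|sk] := eqVneq (sq k) 0; first by rewrite scaler0.
by rewrite coordF // (negPf ki) mulr0 mul0r scale0r.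
Qed.

Let mulG i v : sq i != 0 ->
  mul (G i) v = - ((q i)^-1 * coord e (mate i) v) *: sq i.
Proof.
move=> si; rewrite linearZl_LR mulC mul_basis sq_mateE // !scalerA.
by congr (_ *: _); field; rewrite p0 ?q0.
Qed.

(** One representative, the smaller index, of each pair. *)
Let R : {set 'I_n} := [set i : 'I_n | (sq i != 0) && (i < mate i)%N].

Let R_sq i : i \in R -> sq i != 0.
Proof. by rewrite inE => /andP[]. Qed.

Let R_mate i j : i \in R -> j \in R -> (i == mate j) = false.
Proof.
rewrite !inE => /andP[si lti] /andP[sj ltj]; apply/negP => /eqP ij.
by move: lti; rewrite {2}ij mateK // ij ltnNge ltnW.
Qed.

Let R_mate_eq i j : i \in R -> j \in R -> (mate i == mate j) = (i == j).
Proof.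
move=> /R_sq si /R_sq sj; apply/eqP/eqP => [ij | -> //].
by rewrite -(mateK si) ij mateK.
Qed.

Lemma E2_decomposition_exists :
  exists m : nat, exists U : {vspace E},
    [/\ (m <= n./2)%N, subalgebra mul U, complement_of (ann mul) U
      & iso_E2_sum mul m U].
Proof.
pose r (k : 'I_#|R|) : 'I_n := enum_val k.
have rR (k : 'I_#|R|) : r k \in R by apply: enum_valP.
have rs (k : 'I_#|R|) : sq (r k) != 0 by apply: R_sq.
have r_eq (k l : 'I_#|R|) : (r k == r l) = (k == l) by apply: (inj_eq enum_val_inj).
have [|||||le_dim [U [aU cU isoU]]] :=
    @E2_sum_complement K E mul mulC #|R| (F \o r) (G \o r).
- move=> k l /=; rewrite mulF // coordF // r_eq FGE scalerA.
  congr (_ *: _); have [->|_] := eqVneq k l; first by field; rewrite p0.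
  by rewrite !mulr0 mul0r.
- move=> k l /=; rewrite mulF // coordG R_mate // !mulr0.
  exact: scale0r.
- move=> k l /=; rewrite mulG // coordG R_mate_eq // r_eq FGE scalerA.
  congr (_ *: _); have [->|_] := eqVneq k l.
    by field; rewrite p0 ?q0.
  by rewrite !mulr0 oppr0 mul0r.
- move=> k /=; rewrite FGE scaler_eq0 negb_or rs andbT.
  by rewrite invr_neq0 // expf_neq0 // p0.
- move=> V /subvP annV FGV.
  have RV i : i \in R -> e`_i \in V /\ e`_(mate i) \in V.
    move=> Ri; have [Fi Gi] := FGV (enum_rank_in Ri i).
    rewrite /= /r enum_rankK_in // in Fi Gi; have si := R_sq Ri.
    have pq : (p i ^+ 2)^-1 * q i != 0.
      by rewrite mulf_neq0 ?q0 // invr_neq0 // expf_neq0 // p0.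
    split; last by rewrite -[e`__](scalerK pq) memvZ.
    (* This difference lies in ann(E), its coordinates being zero at all indices of nonzero
       square. *)
    have zV : F i - (p i)^-1 *: e`_i \in V.
      apply/annV/mem_annP => k sk; rewrite linearB /= coordF // linearZ /=.
      by rewrite coord_natural subrr.
    have pV : (p i)^-1 != 0 by rewrite invr_neq0 // p0.
    rewrite -[e`_i](scalerK pV) memvZ //.
    by rewrite -[_ *: _](subKr (F i)) memvB.
  apply: eq_fullv; apply/subvP => v _; rewrite [v]sum_coord memv_suml // => i _.
  apply: memvZ; have [si|si] := eqVneq (sq i) 0; first exact/annV/ann_basis.
  have [lt_im|le_mi] := ltnP i (mate i).
    by apply: (RV i _).1; rewrite inE si.
  rewrite -(mateK si); apply: (RV (mate i) _).2.
  rewrite inE sq_mate // mateK // ltn_neqAle le_mi andbT.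
  exact: mate_neq.
exists #|R|, U; split=> //; move: le_dim; rewrite -size_natural => le_n.
by rewrite -(half_double #|R|) half_leq // -muln2.
Qed.

End Pairing.

(** * Excluding classes of three indices, from a splitting or from SNil(E)^2 = 0 *)

Lemma splits_Asoc1_pairs : 2%N \notin [pchar K] ->
    (forall i, sq i != 0 ->
      exists2 w, abelian_ideal mul <[w]> & coord e i w != 0) ->
    forall U, (Asoc1 mul + U = fullv)%VS -> prodm mul U U = 0%VS ->
  forall i j k, sq i != 0 -> sq j != 0 -> sq k != 0 ->
    i != j -> i != k -> j != k ->
    coord e j (sq i) != 0 -> coord e k (sq i) != 0 -> False.
Proof.
rewrite inE /= => two lines U AU /prodm0P UU.
have AA u v : u \in Asoc1 mul -> v \in Asoc1 mul -> mul u v = 0.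
  by apply: (prodm0P mul _ _).1; apply: Asoc1_abelian.
(* An abelian line with i or j in its support is <s_i>, so the i-th and j-th coordinates of an
   element of Asoc_1(E) are in the same ratio as those of s_i. *)
have ratio i j a : sq i != 0 -> sq j != 0 -> coord e j (sq i) != 0 ->
    a \in Asoc1 mul ->
  coord e j a * coord e i (sq i) = coord e i a * coord e j (sq i).
  move=> si sj cij; move: a; apply: (Asoc1_ind (Q := fun a => _ = _)).
  - by rewrite !linear0 !mul0r.
  - by move=> c u v eu ev; rewrite !linearP /= !mulrDl -!mulrA eu ev !mulrA.
  move=> w w0 aw; have [iw _] := (abelian_lineP mul w).1 aw.
  have [li _] := (abelian_lineP mul _).1 (sq_abelian_line lines si).1.
  have [wi|wi] := eqVneq (coord e i w) 0; last first.
    have /vlineP[c ->] : w \in <[sq i]>%VS.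
      by rewrite -(line_eq_sq iw wi si) memv_line.
    by rewrite !linearZ /=; ring.
  have [wj|wj] := eqVneq (coord e j w) 0; first by rewrite wi wj !mul0r.
  have : w \in <[sq i]>%VS.
    rewrite (_ : <[sq i]>%VS = <[w]>%VS) ?memv_line //.
    by rewrite (line_eq_sq li cij sj) (line_eq_sq iw wj sj).
  by case/vlineP=> c ->; rewrite !linearZ /=; ring.
have split_basis i : exists a u, [/\ a \in Asoc1 mul, u \in U & e`_i = a + u].
  have := memvf e`_i; rewrite -AU => /memv_addP[a Aa [u Uu ->]].
  by exists a, u.
have rel i j : sq i != 0 -> sq j != 0 -> i != j -> coord e j (sq i) != 0 ->
    coord e j (sq i) ^+ 2 *: sq j = - coord e i (sq i) ^+ 2 *: sq i.
  move=> si sj ij cij; have cji := coord_sq_sym lines si sj cij.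
  have [a [u [Aa Uu ei]]] := split_basis i.
  have [b [v [Ab Uv ej]]] := split_basis j.
  (* As A A = U U = 0, only the mixed products x y' and x' y survive, and each can be completed to a
     product with a basis vector. *)
  have aux x y x' y' :
      x \in Asoc1 mul -> x' \in Asoc1 mul -> y \in U -> y' \in U ->
      mul (x + y) (x' + y') = mul x (x' + y') + mul x' (x + y).
    move=> Ax Ax' Uy Uy'; rewrite linearDl; congr (_ + _).
    by rewrite !linearDr (AA x' x) // (UU y y') // addr0 add0r mulC.
  have aii : 2%:R * coord e i a = 1.
    have := aux a u a u Aa Aa Uu Uu; rewrite -ei (mul_basis a) => /eqP.
    rewrite -mulr2n -scaler_nat scalerA -{1}[sq i]scale1r -subr_eq0 -scalerBl.
    by rewrite scaler_eq0 (negPf si) orbF subr_eq0 => /eqP.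
  have bjj : 2%:R * coord e j b = 1.
    have := aux b v b v Ab Ab Uv Uv; rewrite -ej (mul_basis b) => /eqP.
    rewrite -mulr2n -scaler_nat scalerA -{1}[sq j]scale1r -subr_eq0 -scalerBl.
    by rewrite scaler_eq0 (negPf sj) orbF subr_eq0 => /eqP.
  (* Now e_i e_j = 0 reads a_j s_j + b_i s_i = 0. The ratios express a_j and b_i through a_i and
     b_j, which both equal 1/2. *)
  have := aux a u b v Aa Ab Uu Uv; rewrite -ei -ej (e_natural.2 _ _ ij).
  rewrite (mul_basis a) (mul_basis b).
  have := ratio i j a si sj cij Aa; have := ratio j i b sj si cji Ab.
  have [t t0 def_sj] := sq_proportional lines si sj cij.
  have [_ sii] := sq_abelian_line lines si.
  rewrite def_sj !linearZ /= !scalerA -scalerDl => bi aj /esym/eqP.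
  rewrite scaler_eq0 (negPf si) orbF => /eqP ab0; congr (_ *: _).
  move: aii bjj bi aj ab0 cij sii.
  set ai := coord e i a; set aj := coord e j a; set bi := coord e i b.
  set bj := coord e j b; set c := coord e j (sq i); set d := coord e i (sq i).
  move=> aii bjj bi_ aj_ ab0 c0 d0.
  have ajE : aj = ai * c / d by rewrite -aj_ mulfK.
  have biE : bi = bj * d / c.
    by apply: (mulIf (mulf_neq0 t0 c0)); rewrite bi_; field; rewrite c0.
  have abE : ai = bj by apply: (mulfI two); rewrite aii bjj.
  have bj0 : bj != 0.
    by apply: contraTneq (oner_neq0 K) => bj0; rewrite -bjj bj0 mulr0 eqxx.
  have : bj * (c ^+ 2 * t + d ^+ 2) = (t * aj + bi) * (c * d).
    by rewrite ajE biE abE; field; rewrite c0.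
  rewrite ab0 mul0r => /eqP; rewrite mulf_eq0 (negPf bj0) /= addr_eq0 => /eqP.
  by rewrite mulrC.
move=> i j k si sj sk ij ik jk cij cik.
have [t t0 def_sj] := sq_proportional lines si sj cij.
have [_ sii] := sq_abelian_line lines si.
have relj := rel i j si sj ij cij; have relk := rel i k si sk ik cik.
have cjk : coord e k (sq j) != 0 by rewrite def_sj linearZ /= mulf_neq0.
have tE l : coord e l (sq j) = t * coord e l (sq i) by rewrite def_sj linearZ.
(* Cancelling t^2 gives (s_i)_k^2 s_k = - (s_i)_j^2 s_j. By the relations from i, the left side is -
   (s_i)_i^2 s_i and the right side its opposite, so 2 (s_i)_i^2 s_i = 0. *)
have := rel j k sj sk jk cjk; rewrite !tE !exprMn -mulrN.
rewrite -[LHS]scalerA -[RHS]scalerA relk !scaleNr relj scaleNr opprK => /(scalerI (expf_neq0 2 t0))/esym/eqP.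
rewrite -addr_eq0 -mulr2n -scaler_nat scalerA scaler_eq0 mulf_eq0 sqrf_eq0.
by rewrite (negPf two) (negPf sii) (negPf si).
Qed.

Lemma SNil_square_pairs : prodm mul (SNil mul) (SNil mul) = 0%VS ->
    (forall i, sq i != 0 ->
      exists2 w, abelian_ideal mul <[w]> & coord e i w != 0) ->
  forall i j k, sq i != 0 -> sq j != 0 -> sq k != 0 ->
    i != j -> i != k -> j != k ->
    coord e j (sq i) != 0 -> coord e k (sq i) != 0 -> False.
Proof.
move=> /prodm0P SS lines i j k si sj sk ij ik jk cij cik.
have [/(abelian_lineP mul)[li ss] sii] := sq_abelian_line lines si.
have annih (l : 'I_n) : sq l != 0 -> coord e l (sq i) != 0 ->
    exists2 c, c != 0 & c *: e`_i - coord e i (sq i) *: e`_l \in SNil mul.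
  move=> sl cil; have [t t0 def_sl] := sq_proportional lines si sl cil.
  (* With s_l = t s_i, this coefficient makes the combination annihilate s_i. *)
  exists (coord e l (sq i) * t); first by rewrite mulf_neq0.
  apply: (mem_SNil mulC li ss) => [v|].
    rewrite linearBr !linearZr_LR (mul_basis v i) (mul_basis v l) def_sl.
    by rewrite memvB // !memvZ ?memv_line.
  rewrite mulC linearBr !linearZr_LR (mul_basis (sq i) i) (mul_basis (sq i) l).
  rewrite def_sl !scalerA.
  by apply/eqP; rewrite subr_eq0; apply/eqP; congr (_ *: _); ring.
have [c c0 Sx] := annih j sj cij; have [d d0 Sy] := annih k sk cik.
(* For distinct i, j, k the only surviving term of the product is c d s_i. *)
have := SS _ _ Sx Sy; have mul0 := e_natural.2.
rewrite !linearBl !linearBr /= !linearZl_LR !linearZr_LR.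
rewrite (mul0 i k) // (mul0 j k) // (mul0 j i) 1?eq_sym // !scaler0 !subr0.
by move/eqP; rewrite !scaler_eq0 (negPf c0) (negPf d0) (negPf si).
Qed.

End NaturalBasis.

(** * The cycle of implications under full support of SNil(E) *)

Theorem theorem4p6 (K : fieldType) (char_neq2 : 2%N \notin [pchar K])
    (E : vectType K) (mul : {bilinear E -> E -> E})
    (n : nat) (e : n.-tuple E) (e_natural : natural_basis mul e)
    (supp_SNil : suppv e (SNil mul) = suppv e fullv) :
  [<-> phi_free mul;
       splits_over mul (Asoc1 mul);
       exists m : nat, exists U : {vspace E},
         [/\ (m <= n./2)%N, subalgebra mul U, complement_of (ann mul) U
           & iso_E2_sum mul m U];
       prodm mul (SNil mul) (SNil mul) = 0%VS /\ SNil mul = N1 mul e].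
Proof.
have mulC := natural_basis_mulC e_natural.
have E2S := full_supp_square e_natural (SNil_ideal mulC) supp_SNil.
have full_supp (i : 'I_n) : i \in suppv e (SNil mul).
  rewrite supp_SNil; apply/mem_suppv; exists e`_i; first exact: memvf.
  by rewrite (coord_natural e_natural) eqxx oner_eq0.
(* The implication from (iii) to (i) is isolated because (iv) leads back to (i) by first rebuilding
   the decomposition of (iii). *)
have E2_phi_free : (exists m : nat, exists U : {vspace E},
    [/\ (m <= n./2)%N, subalgebra mul U, complement_of (ann mul) U
      & iso_E2_sum mul m U]) -> phi_free mul.
  case=> m [U [_ _ annU [f [kerf imf fM]]]].
  exact: (E2_decomposition_phi_free mulC annU kerf imf fM).
tfae.
- exact: phi_free_splits (Asoc1_ideal mulC) (Asoc1_abelian mulC).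
- case=> U aU AU; have [SA UU] := splits_Asoc1_SNil mulC aU AU E2S.
  have lines (i : 'I_n) : mul e`_i e`_i != 0 ->
      exists2 w, abelian_ideal mul <[w]> & coord e i w != 0.
    by move=> _; apply: supp_Asoc1; rewrite -SA.
  apply: (E2_decomposition_exists e_natural lines).
  exact: (splits_Asoc1_pairs e_natural char_neq2 lines AU.1 UU).
- case=> m [U [_ _ annU [f [kerf imf fM]]]].
  split; first exact: (E2_decomposition_SNil_square mulC annU kerf imf fM).
  apply/eqP; rewrite eqEsubv (N1_sub_SNil e_natural) andbT.
  apply: (E2_decomposition_SNil_sub mulC annU kerf imf fM) => [|w aw nw].
    exact: addvSr.
  exact: (mem_N1 e_natural).
case=> SS SN1; apply: E2_phi_free.
have lines (i : 'I_n) : mul e`_i e`_i != 0 ->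
    exists2 w, abelian_ideal mul <[w]> & coord e i w != 0.
  by move=> si; apply: (supp_N1 e_natural); rewrite -?SN1.
apply: (E2_decomposition_exists e_natural lines).
exact: (SNil_square_pairs e_natural SS lines).
Qed.
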